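(* Let $0<\alpha<1$, $0<T<\infty$, and let $\epsilon$ and $A$ be positive constants. There exists a positive constant $\tau^*$ depending only on $\alpha$, $A$ and $T$ such that the following holds. If $V\in\mathcal W_{h,\tau}$ satisfies $$\|\mathrm D_{0+}^{\alpha/2}V\|_{L^2(0,t_j;L^2(\Omega))}^2\le\epsilon+A\|V\|_{L^2(0,t_j;L^2(\Omega))}^2\qquad\text{for all }1\le j\le J,$$ and if $\tau<\tau^*$, then $$\|\mathrm D_{0+}^{\alpha/2}V\|_{L^2(0,t_j;L^2(\Omega))}\le\sqrt\epsilon\;C\exp\Big(\tfrac12\,j\,\sigma\,T\,J^{-1}(\tau^*-\tau)^{-1}\Big)\qquad\text{for each }1\le j\le J,$$ where $C>0$ depends only on $\alpha$, $A$ and $T$.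
   Context: $\Omega\subset\mathbb R^d$ ($d=1,2,3$) is a convex $d$-polytope; $\mathcal K_h$ is a conforming, shape regular triangulation of $\Omega$ into $d$-simplexes with maximum element diameter $h$; $\mathcal V_h:=\{v_h\in H_0^1(\Omega): v_h|_K\text{ is linear for each }K\in\mathcal K_h\}$. Temporal grid: $J\in\mathbb N_{>0}$, $\sigma\ge1$, $t_j:=(j/J)^\sigma T$ for $0\le j\le J$, $\tau_j:=t_j-t_{j-1}$ for $1\le j\le J$, and $\tau:=\tau_J$. $\mathcal W_{h,\tau}:=\{V\in L^2(0,T;\mathcal V_h): V|_{(t_{j-1},t_j)}\text{ is constant (in time) for each }1\le j\le J\}$. $\mathrm D_{0+}^{\alpha/2}$ is the Riemann-Liouville derivative: $\mathrm D_{0+}^{\alpha/2}V:=\mathrm D\,\mathrm D_{0+}^{\alpha/2-1}V$ with $(\mathrm D_{0+}^{\alpha/2-1}V)(t):=\frac1{\Gamma(1-\alpha/2)}\int_0^t(t-s)^{-\alpha/2}V(s)\,ds$ and $\mathrm D$ the distributional derivative in time. *)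

(* Defs.v *)
From HB Require Import structures.
From mathcomp Require Import all_boot all_order all_algebra.
From mathcomp Require Import all_classical all_reals all_analysis.

Set Implicit Arguments.
Unset Strict Implicit.
Unset Printing Implicit Defensive.

Import Order.TTheory GRing.Theory Num.Theory.
Import numFieldNormedType.Exports.

Local Open Scope classical_set_scope.
Local Open Scope ring_scope.

(* Measurable structure of R^d = 'rV[R]_d: the product sigma-algebra, generated
   by the coordinates (it coincides with the Borel sigma-algebra). *)

Definition rV_display : measure_display.
Proof. exact: default_measure_display. Qed.

Section rV_measurable.
Context {R : realType} {d : nat}.

Definition rV_coord (i : 'I_d) (x : 'rV[R]_d) : measurableTypeR R := x ord0 i.

Let rV_set0 : g_sigma_preimage rV_coord set0.
Proof. exact: sigma_algebra0. Qed.

Let rV_setC A : g_sigma_preimage rV_coord A -> g_sigma_preimage rV_coord (~` A).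
Proof. exact: sigma_algebraC. Qed.

Let rV_bigcup (F : _^nat) : (forall i, g_sigma_preimage rV_coord (F i)) ->
  g_sigma_preimage rV_coord (\bigcup_i (F i)).
Proof. exact: sigma_algebra_bigcup. Qed.

HB.instance Definition _ := @isMeasurable.Build rV_display
  'rV[R]_d (g_sigma_preimage rV_coord) rV_set0 rV_setC rV_bigcup.

End rV_measurable.

Lemma measurable_rV_coord (R : realType) d (i : 'I_d) :
  measurable_fun [set: 'rV[R]_d] (rV_coord i).
Proof.
move=> _ Y mY; rewrite setTI; apply: sub_sigma_algebra => /=.
rewrite -bigcup_seq/=; exists i => /=; first by rewrite mem_index_enum.
by exists Y => //; rewrite setTI.
Qed.

Lemma measurable_fun_rVP (R : realType) d0 (T : measurableType d0) d
    (f : T -> 'rV[R]_d) :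
  (forall i, measurable_fun [set: T] (rV_coord i \o f)) ->
  measurable_fun [set: T] f.
Proof.
move=> mf _ A mA; rewrite setTI.
have [+ _] : sigma_algebra setT [set B | measurable (f @^-1` B)] /\ True.
  split=> //; split.
  - by rewrite /= preimage_set0.
  - move=> B /= mB; rewrite setTD preimage_setC; exact: measurableC.
  - by move=> F mF /=; rewrite preimage_bigcup; exact: bigcupT_measurable.
move=> sA; apply: (mA [set B | measurable (f @^-1` B)]); split => //.
rewrite -bigcup_seq => B [i _ [Y mY <-]] /=.
by rewrite setTI -comp_preimage -[X in measurable X]setTI; exact: mf.
Qed.

(* Lebesgue measure on R^d, by iterating the product with the one on R. *)

Section lebesgue_cons.
Context {R : realType} {d : nat}.
Local Notation Rm := (measurableTypeR R).

Definition rV_cons (p : Rm * 'rV[R]_d) : 'rV[R]_d.+1 :=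
  row_mx (const_mx p.1 : 'rV[R]_1) p.2.

Definition rV_uncons (x : 'rV[R]_d.+1) : Rm * 'rV[R]_d :=
  (x ord0 ord0, \row_i x ord0 (lift ord0 i)).

Lemma rV_consK : cancel rV_cons rV_uncons.
Proof.
move=> [a x]; congr pair; rewrite /rV_cons/=.
  by rewrite mxE; case: splitP => // j _; rewrite mxE.
apply/rowP => i; rewrite mxE.
have -> : lift ord0 i = rshift 1 i by apply: ord_inj.
exact: (row_mxEr (const_mx a : 'rV[R]_1) x ord0 i).
Qed.

Lemma rV_unconsK : cancel rV_uncons rV_cons.
Proof.
move=> x; apply/rowP => i; rewrite /rV_cons/= mxE.
case: splitP => j ij; rewrite mxE.
  by rewrite (_ : ord0 = i)//; apply: ord_inj; rewrite /= ij ord1.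
by rewrite (_ : lift ord0 j = i)//; apply: ord_inj; rewrite /= ij.
Qed.

Lemma measurable_rV_cons : measurable_fun setT rV_cons.
Proof.
apply: measurable_fun_rVP => i.
have [->|i0] := eqVneq i ord0.
  rewrite (_ : _ \o _ = fst) //; apply/funext => p.
  by rewrite -[in RHS](rV_consK p).
have [j ->] : exists j, i = lift ord0 j.
  by case: (unliftP ord0 i) i0 => [j -> _|->]; [exists j|rewrite eqxx].
rewrite (_ : _ \o _ = rV_coord j \o snd).
  by apply: measurableT_comp => //; exact: measurable_rV_coord.
by apply/funext => p; rewrite /rV_coord/= -[in RHS](rV_consK p)/= mxE.
Qed.

Lemma measurable_rV_uncons : measurable_fun setT rV_uncons.
Proof.
apply/measurable_fun_pairP; split.
  exact: (measurable_rV_coord ord0).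
apply: measurable_fun_rVP => i.
rewrite (_ : _ \o _ = rV_coord (lift ord0 i)); first exact: measurable_rV_coord.
by apply/funext => x; rewrite /rV_coord/= mxE.
Qed.

Variable m : {sigma_finite_measure set 'rV[R]_d -> \bar R}.

Definition lebesgue_cons : set 'rV[R]_d.+1 -> \bar R :=
  pushforward (@lebesgue_measure R \x m)%E rV_cons.

Let lebesgue_cons0 : lebesgue_cons set0 = 0%E.
Proof. by rewrite /lebesgue_cons /pushforward preimage_set0 measure0. Qed.

Let lebesgue_cons_ge0 A : (0 <= lebesgue_cons A)%E.
Proof. by rewrite /lebesgue_cons /pushforward; exact: measure_ge0. Qed.

Let lebesgue_cons_sigma_additive : semi_sigma_additive lebesgue_cons.
Proof.
move=> F mF tF mUF; rewrite /lebesgue_cons /pushforward preimage_bigcup.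
apply: measure_semi_sigma_additive.
- by move=> n; rewrite -[X in measurable X]setTI; exact: measurable_rV_cons.
- apply/trivIsetP => /= i j _ _ ij; rewrite -preimage_setI.
  by move/trivIsetP : tF => /(_ _ _ _ _ ij) ->//; rewrite preimage_set0.
- rewrite -preimage_bigcup -[X in measurable X]setTI.
  exact: measurable_rV_cons.
Qed.

HB.instance Definition _ := isMeasure.Build _ _ _ lebesgue_cons
  lebesgue_cons0 lebesgue_cons_ge0 lebesgue_cons_sigma_additive.

Let lebesgue_cons_sigma_finite : sigma_finite setT lebesgue_cons.
Proof.
have [F TF Foo] : sigma_finite setT (@lebesgue_measure R \x m)%E.
  have /sigma_finiteP[F [TF ndF Foo]] := sigma_finiteT (@lebesgue_measure R).
  have /sigma_finiteP[G [TG ndG Goo]] := sigma_finiteT m.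
  exists (fun n => F n `*` G n).
    rewrite -setXTT TF TG predeqE => -[x y]; split.
      move=> [/= [n _ Fnx] [k _ Gky]]; exists (maxn n k) => //; split.
      - by move: x Fnx; exact/subsetPset/ndF/leq_maxl.
      - by move: y Gky; exact/subsetPset/ndG/leq_maxr.
    by move=> [n _ []/= ? ?]; split; exists n.
  move=> k; have [? ?] := Foo k; have [? ?] := Goo k.
  split; first exact: measurableX.
  by rewrite product_measure1E// lte_mul_pinfty// ge0_fin_numE.
exists (fun n => rV_uncons @^-1` F n).
  by rewrite -preimage_bigcup -TF preimage_setT.
move=> n; have [mF Fn] := Foo n; split.
  by rewrite -[X in measurable X]setTI; exact: measurable_rV_uncons.
rewrite /lebesgue_cons /pushforward -comp_preimage.
rewrite (_ : rV_uncons \o rV_cons = id) ?preimage_id//.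
by apply/funext => p; exact: rV_consK.
Qed.

HB.instance Definition _ := Measure_isSigmaFinite.Build _ _ _ lebesgue_cons
  lebesgue_cons_sigma_finite.

End lebesgue_cons.

Fixpoint lebesgueRd (R : realType) (d : nat) :
    {sigma_finite_measure set 'rV[R]_d -> \bar R} :=
  match d with
  | 0 => \d_(0 : 'rV[R]_0)
  | d'.+1 => lebesgue_cons (lebesgueRd R d')
  end.

Section space.
Context {R : realType} {d : nat}.
Implicit Types (Omega : set 'rV[R]_d) (v : 'rV[R]_d -> R).

Definition eucl_norm (x : 'rV[R]_d) : R := Num.sqrt (\sum_i x ord0 i ^+ 2).

Definition conv_hull (S : set 'rV[R]_d) : set 'rV[R]_d :=
  [set x | exists n (p : 'I_n -> 'rV[R]_d) (w : 'I_n -> R),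
    [/\ forall i, S (p i), forall i, 0 <= w i,
        \sum_i w i = 1 & x = \sum_i w i *: p i]].

(* The domain is the open set; the d-polytope is its closure, the
   full-dimensional convex hull of finitely many points. *)
Definition convex_polytope Omega : Prop :=
  exists2 S : set 'rV[R]_d, finite_set S &
    Omega = (conv_hull S)° /\ Omega !=set0.

Definition affinely_independent n (p : 'I_n -> 'rV[R]_d) : Prop :=
  forall w : 'I_n -> R, \sum_i w i = 0 -> \sum_i w i *: p i = 0 ->
    forall i, w i = 0.

Definition simplex (p : 'I_d.+1 -> 'rV[R]_d) : set 'rV[R]_d :=
  conv_hull (range p).

Definition diameter (K : set 'rV[R]_d) : R :=
  sup [set r | exists x y, [/\ K x, K y & r = eucl_norm (x - y)]].

Definition indiameter (K : set 'rV[R]_d) : R :=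
  sup [set r | 0 <= r /\ exists c, [set x | eucl_norm (x - c) <= r / 2] `<=` K].

(* Conforming, kappa-shape-regular triangulation of Omega with mesh size h:
   two distinct simplexes meet exactly in the face spanned by their common
   vertices (possibly empty). *)
Record triangulation Omega N (K : 'I_N -> 'I_d.+1 -> 'rV[R]_d)
    (kappa h : R) : Prop := Triangulation {
  tri_nondegenerate : forall i, affinely_independent (K i) ;
  tri_distinct : forall i j, range (K i) = range (K j) -> i = j ;
  tri_cover : closure Omega = \bigcup_(i in [set: 'I_N]) simplex (K i) ;
  tri_conforming : forall i j, i != j ->
    simplex (K i) `&` simplex (K j) = conv_hull (range (K i) `&` range (K j)) ;
  tri_shape_regular : forall i,
    diameter (simplex (K i)) <= kappa * indiameter (simplex (K i)) ;
  tri_mesh_size : h = \big[Num.max/0]_(i < N) diameter (simplex (K i)) }.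

Definition sqnorm_L2 Omega v : \bar R :=
  \int[lebesgueRd R d]_(x in Omega) ((v x) ^+ 2)%:E.

Definition in_L2 Omega v : Prop :=
  measurable_fun Omega v /\ (sqnorm_L2 Omega v < +oo)%E.

Definition iter_derive (us : seq 'rV[R]_d) v : 'rV[R]_d -> R :=
  foldr (fun u g => 'D_u g) v us.

Definition partial (i : 'I_d) v : 'rV[R]_d -> R := 'D_(delta_mx ord0 i) v.

Definition smooth v : Prop := forall us : seq 'rV[R]_d,
  continuous (iter_derive us v) /\
  forall x u, derivable (iter_derive us v) x u.

Definition test_function Omega (phi : 'rV[R]_d -> R) : Prop :=
  smooth phi /\
  exists2 K : set 'rV[R]_d, compact K /\ K `<=` Omega &
    forall x, ~ K x -> phi x = 0.

Definition weak_partial Omega (i : 'I_d) v g : Prop :=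
  forall phi, test_function Omega phi ->
    \int[lebesgueRd R d]_(x in Omega) (v x * partial i phi x) =
    - \int[lebesgueRd R d]_(x in Omega) (g x * phi x).

(* H^1_0 is the closure of the test functions in H^1; g is the weak gradient. *)
Definition in_H10 Omega v : Prop :=
  in_L2 Omega v /\
  exists g : 'I_d -> 'rV[R]_d -> R,
    (forall i, in_L2 Omega (g i) /\ weak_partial Omega i v (g i)) /\
    exists phi : nat -> 'rV[R]_d -> R,
      [/\ forall n, test_function Omega (phi n),
          sqnorm_L2 Omega (fun x => phi n x - v x) @[n --> \oo] --> 0%E &
          forall i, sqnorm_L2 Omega (fun x => partial i (phi n) x - g i x)
            @[n --> \oo] --> 0%E].

(* Elements of V_h are represented by their continuous versions on Omega:
   "linear" (that is, affine) holds pointwise on each simplex. *)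
Definition in_Vh Omega N (K : 'I_N -> 'I_d.+1 -> 'rV[R]_d) v : Prop :=
  in_H10 Omega v /\
  forall i, exists (a : 'rV[R]_d) (b : R), forall x,
    Omega x -> simplex (K i) x -> v x = \sum_k a ord0 k * x ord0 k + b.

End space.

Section time.
Context {R : realType}.

Definition tgrid (T sigma : R) (J j : nat) : R := (j%:R / J%:R) `^ sigma * T.

Definition Gamma (z : R) : R :=
  \int[lebesgue_measure]_(t in `]0, +oo[) (t `^ (z - 1) * expR (- t)).

Definition time_test (T : R) (phi : R -> R) : Prop :=
  (forall n t, derivable (derive1n n phi) t 1) /\
  exists a b, [/\ 0 < a, b < T & forall t, ~~ (a <= t <= b) -> phi t = 0].

Context {d : nat}.
Implicit Types (Omega : set 'rV[R]_d) (U V W G : R -> 'rV[R]_d -> R).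

Definition norm_L2L2 Omega (t : R) U : \bar R :=
  (\int[lebesgue_measure]_(s in `]0%R, t[) sqnorm_L2 Omega (U s)) `^ (2^-1)%R.

Definition in_L2L2 Omega (T : R) U : Prop :=
  measurable_fun (`]0, T[ `*` Omega : set (measurableTypeR R * 'rV[R]_d))
    (fun p => U p.1 p.2) /\
  (norm_L2L2 Omega T U < +oo)%E.

(* The piecewise constant in time, V_h-valued functions, represented by
   functions that are exactly constant on each open subinterval. *)
Definition in_W Omega N (K : 'I_N -> 'I_d.+1 -> 'rV[R]_d)
    (T sigma : R) (J : nat) V : Prop :=
  [/\ in_L2L2 Omega T V,
      {ae (@lebesgue_measure R), forall t, 0 < t < T -> in_Vh Omega K (V t)} &
      forall j, (1 <= j <= J)%N -> forall s t,
        tgrid T sigma J j.-1 < s < tgrid T sigma J j ->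
        tgrid T sigma J j.-1 < t < tgrid T sigma J j ->
        forall x, Omega x -> V s x = V t x].

(* The Riemann-Liouville integral of order beta, i.e. D_{0+}^{- beta}. *)
Definition RL_integral (beta : R) V : R -> 'rV[R]_d -> R := fun t x =>
  (Gamma beta)^-1 *
  \int[lebesgue_measure]_(s in `]0, t[) ((t - s) `^ (beta - 1) * V s x).

(* G is the distributional time derivative of W : ]0, T[ -> L^2(Omega).  The
   Bochner integrals in L^2(Omega) against a test function are computed
   pointwise, for almost every x. *)
Definition distr_derivative Omega (T : R) W G : Prop :=
  forall phi, time_test T phi ->
    {ae lebesgueRd R d, forall x, Omega x ->
      \int[lebesgue_measure]_(t in `]0, T[) (W t x * derive1 phi t) =
      - \int[lebesgue_measure]_(t in `]0, T[) (G t x * phi t)}.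

(* G = D_{0+}^gamma V for 0 < gamma < 1, when this distribution lies in
   L^2(0, T; L^2(Omega)); G is then unique up to a null set.  For V in W and
   gamma < 1/2 such a G exists, since V jumps only at the nodes. *)
Definition is_RL_derivative Omega (T gamma : R) V G : Prop :=
  in_L2L2 Omega T G /\
  distr_derivative Omega T (RL_integral (1 - gamma) V) G.

End time.

(* Main.v *)
Require Import Defs.
From mathcomp Require Import all_boot all_order all_algebra.
From mathcomp Require Import all_classical all_reals all_analysis.
From mathcomp Require Import measurable_realfun ring lra.
Import Order.TTheory GRing.Theory Num.Theory.
Import numFieldNormedType.Exports.
Local Open Scope classical_set_scope.
Local Open Scope ring_scope.

(** Write g = alpha/2, t_0 < ... < t_J for the grid, c_j(x) for the constant
    value of V(., x) on the cell ]t_j, t_(j+1)[, and G = DV.  The only analytic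
    fact needed about the fractional derivative is that it controls the cell
    values: inverting the Riemann-Liouville operator, and integrating over
    ]0, t_i[, gives for almost every x the finitely many moment identities
      sum_(j < i) c_j (t_(j+1) - t_j)
        = kappa * int_0^T G(s, x) (t_i - s)_+^g ds,     i <= J,
    with kappa = Gamma(1 - g) / B(1 - g, 1 + g) (lemma [node_identity]).
    They are read off the definition of the distributional derivative by
    testing against smooth functions converging boundedly to (t_i - s)_+^g
    ([cutoff_ppow]).  On the side of V the Riemann-Liouville integral of a step
    function is explicit ([RL_step]), an integration by parts moves the
    derivative back from the test function ([by_parts]), and in the limit each
    term is a Beta integral, linear in the cell ([beta_integral]).  Working with
    countably many test functions is what makes one null set of points x enough.

    Subtracting two consecutive identities, c_j (t_(j+1) - t_j) is kappa times
    the integral of G against the kernel (t_(j+1) - s)_+^g - (t_j - s)_+^g.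
    Split this kernel at distance delta before the cell.  The near part has small
    mass, both in s and summed over the cells ([near_kernel_mass],
    [sum_near_kernel]); the far part is at most a constant times the length of
    the cell, and sees only G before t_j ([far_kernel_lipschitz]).  A weighted
    Cauchy-Schwarz inequality then yields, with Q_j the squared L2 norm of
    G(., x) on ]0, t_j[,
      sum_(j < k) (t_(j+1) - t_j) c_j^2
        <= near * Q_k + far * sum_(j < k) (t_(j+1) - t_j) Q_j
    ([discrete_bound]), where near is small with delta and the largest step,
    while far depends on g, delta and T only.  Tonelli's theorem turns this into
    the same inequality between space-time norms ([energy_bound]).

    It remains to choose delta so that A * near <= 1/2.  With Q_k now the squared
    space-time norm of DV on ]0, t_k[ and L = 2 A far, the hypothesis on V gives
      Q_k <= 2 epsilon + L * sum_(j < k) (t_(j+1) - t_j) Q_j,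
    and a discrete Gronwall inequality gives Q_k <= 2 epsilon exp(L k tau).  Since
    the last and largest step tau is at most sigma T / J, any positive tau_star
    with tau_star <= delta and L tau_star <= 1, and C = sqrt 2, are as required. *)

Set Implicit Arguments.
Unset Strict Implicit.
Unset Printing Implicit Defensive.

(** * Real-valued integrals *)

Section rint.
Context d (T : measurableType d) (R : realType).
Variable mu : {measure set T -> \bar R}.
Implicit Types (A B D : set T) (f g h : T -> R).

Lemma le_integrableR D f g : measurable D -> measurable_fun D f ->
  (forall x, D x -> `|f x| <= g x) ->
  mu.-integrable D (EFin \o g) -> mu.-integrable D (EFin \o f).
Proof.
move=> mD mf fg; apply: le_integrable => //; first exact/measurable_EFinP.
by move=> x Dx; rewrite lee_fin (le_trans (fg x Dx))// ler_norm.
Qed.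

Lemma measurable_integrableR D f : measurable D ->
  mu.-integrable D (EFin \o f) -> measurable_fun D f.
Proof. by move=> mD /integrableP[/measurable_EFinP]. Qed.

Lemma integrableRZ D k f : measurable D -> mu.-integrable D (EFin \o f) ->
  mu.-integrable D (EFin \o (fun x => k * f x)).
Proof. by move=> mD intf; exact: (integrableZl mD k intf). Qed.

Lemma integrableRD D f g : measurable D -> mu.-integrable D (EFin \o f) ->
  mu.-integrable D (EFin \o g) ->
  mu.-integrable D (EFin \o (fun x => f x + g x)).
Proof. by move=> mD intf intg; exact: (integrableD mD intf intg). Qed.

Lemma integrableRB D f g : measurable D -> mu.-integrable D (EFin \o f) ->
  mu.-integrable D (EFin \o g) ->
  mu.-integrable D (EFin \o (fun x => f x - g x)).
Proof. by move=> mD intf intg; exact: (integrableB mD intf intg). Qed.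

Lemma integrableRM_bounded D f h M : measurable D ->
  mu.-integrable D (EFin \o f) -> measurable_fun D h ->
  (forall x, D x -> `|h x| <= M) ->
  mu.-integrable D (EFin \o (fun x => f x * h x)).
Proof.
move=> mD intf mh hM.
apply: (@le_integrableR _ _ (fun x => M * `|f x|)) => //.
- by apply: measurable_funM => //; exact: measurable_integrableR.
- by move=> x Dx; rewrite normrM mulrC ler_wpM2r// hM.
- by apply: integrableRZ => //; exact: (integrable_norm intf).
Qed.

Lemma integrableR_sum D n (f : 'I_n -> T -> R) : measurable D ->
  (forall i, mu.-integrable D (EFin \o f i)) ->
  mu.-integrable D (EFin \o (fun x => \sum_(i < n) f i x)).
Proof.
move=> mD; elim: n f => [|n IH] f intf.
  by under eq_fun do rewrite big_ord0; exact: integrable0.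
under eq_fun do rewrite big_ord_recl.
by apply: integrableRD => //; exact: IH.
Qed.

Lemma Rintegral_sum D n (f : 'I_n -> T -> R) : measurable D ->
  (forall i, mu.-integrable D (EFin \o f i)) ->
  \int[mu]_(x in D) (\sum_(i < n) f i x) = \sum_(i < n) \int[mu]_(x in D) f i x.
Proof.
move=> mD; elim: n f => [|n IH] f intf.
  rewrite big_ord0; under eq_Rintegral do rewrite big_ord0.
  by rewrite Rintegral_cst// mul0r.
under eq_Rintegral do rewrite big_ord_recl.
rewrite RintegralD//; last exact: integrableR_sum.
by rewrite big_ord_recl IH.
Qed.

Lemma Rintegral_support A B f : A `<=` B -> (forall x, B x -> ~ A x -> f x = 0) ->
  \int[mu]_(x in B) f x = \int[mu]_(x in A) f x.
Proof.
move=> AB f0; rewrite Rintegral_mkcond [RHS]Rintegral_mkcond; congr Rintegral.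
apply/funext => x; rewrite !patchE; case: ifPn; case: ifPn => //.
  by rewrite !notin_setE inE => Ax Bx; rewrite f0.
by rewrite inE notin_setE => /AB.
Qed.

Lemma integrable_support A B f : measurable A -> measurable B -> A `<=` B ->
  (forall x, B x -> ~ A x -> f x = 0) ->
  mu.-integrable A (EFin \o f) -> mu.-integrable B (EFin \o f).
Proof.
move=> mA mB AB f0 /(integrable_mkcond _ mA) intf.
apply/(integrable_mkcond _ mB); move: intf; congr (is_true (_.-integrable _ _)).
apply/funext => x; rewrite !patchE; case: ifPn; case: ifPn => //.
  by rewrite notin_setE inE => nBx /AB.
by rewrite inE notin_setE => Bx nAx; rewrite /= f0.
Qed.

End rint.

(** * The fundamental theorem of calculus with endpoint singularities *)

Section ftc.
Context {R : realType}.
Local Notation mu := (@lebesgue_measure R).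

(** Inside ]a, b[ the primitive of f has the same derivative as F, and it is
    continuous up to the endpoints because f is integrable.  Thus f may blow up at
    a and b, as the kernels of fractional calculus do. *)
Lemma FTC2_open (F f : R -> R) (a b : R) : a < b -> continuous F ->
  (forall x, a < x < b -> is_derive x 1 F (f x)) ->
  (forall x, a < x < b -> {for x, continuous f}) ->
  mu.-integrable `]a, b[ (EFin \o f) ->
  \int[mu]_(x in `]a, b[) f x = F b - F a.
Proof.
move=> ab cF dF cf intf.
pose f0 := f \_ `]a, b[.
have intf0 : mu.-integrable setT (EFin \o f0).
  by move: intf; rewrite (integrable_mkcond _)// restrict_EFin.
have intf0S (A : set R) : measurable A -> mu.-integrable A (EFin \o f0).
  by move=> mA; apply: integrableS intf0.
pose G (x : R) := \int[mu]_(t in `[a, x]) f0 t.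
have dG x : x \in `]a, b[ -> is_derive x 1 (F - G) 0.
  rewrite in_itv/= => /andP[ax xb].
  have cf0 : {for x, continuous f0}.
    have f0x : f0 x = f x by rewrite /f0 patchE mem_set//= in_itv/= ax.
    rewrite /prop_for /continuous_at f0x; apply: cvg_trans (cf x _); last by rewrite ax.
    apply: near_eq_cvg; near=> y; rewrite /f0 patchE mem_set//=.
    near: y; apply: (@open_nbhs_nbhs _ x `]a, b[%classic).
    by split; [exact: itv_open|rewrite /= in_itv/= ax].
  have [dG G'] := @continuous_FTC1_closed R f0 a x b xb (intf0S _ (measurable_itv _)) ax cf0.
  have -> : 0 = f x - f0 x :> R.
    by rewrite /f0 patchE mem_set/= ?in_itv/= ?ax ?xb// subrr.
  apply: is_deriveB.
    by apply: dF; rewrite ax.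
  apply: DeriveDef; first exact: dG.
  by rewrite -derive1E; exact: G'.
have [|c _] := MVT ab dG.
  move=> x; apply: cvgB; first exact: continuous_subspaceT.
  by apply: parameterized_integral_continuous (ltW ab) (intf0S _ (measurable_itv _)) x.
rewrite mul0r !fctE => /eqP; rewrite subr_eq0 => /eqP.
rewrite [G a]/G set_itv1 Rintegral_set1 subr0 => <-.
rewrite opprB addrCA subrr addr0 /G /f0 -Rintegral_mkcondr.
by congr Rintegral; rewrite setIidr//; exact: subset_itv_oo_cc.
Unshelve. all: by end_near. Qed.


(** Monotone convergence along an exhaustion of ]a, b[ by compact intervals, on
    which the integrals of f are increments of the continuous function F. *)
Lemma FTC2_open_ge0 (F f : R -> R) (a b : R) : a < b -> continuous F ->
  (forall x, a < x < b -> is_derive x 1 F (f x)) ->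
  (forall x, a < x < b -> {for x, continuous f}) ->
  (forall x, a < x < b -> 0 <= f x) ->
  mu.-integrable `]a, b[ (EFin \o f).
Proof.
move=> ab cF dF cf f0.
have mf : measurable_fun `]a, b[ f.
  apply: open_continuous_measurable_fun; first exact: itv_open.
  by move=> x; rewrite inE/= in_itv/=; exact: cf.
apply/integrableP; split; first exact/measurable_EFinP.
(* a quarter of the length keeps a + h n < b - h n from n = 0 on *)
pose h n : R := (b - a) / 4%:R * harmonic n.
have h0 n : 0 < h n by rewrite mulr_gt0// ?divr_gt0 ?subr_gt0 ?invr_gt0.
have h4 n : h n <= (b - a) / 4%:R.
  rewrite -[leRHS]mulr1 ler_wpM2l ?divr_ge0 ?subr_ge0 ?(ltW ab)//.
  by rewrite /harmonic invf_le1 ?ler1n.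
have hcvg : h @ \oo --> 0.
  by rewrite -[0](mulr0 ((b - a) / 4%:R)); apply: cvgMr; exact: cvg_harmonic.
pose A n : set R := `]a + h n, b - h n[%classic.
have subA n : A n `<=` `]a, b[.
  move=> x; rewrite /A/= !in_itv/= => /andP[x1 x2]; have hn := h0 n.
  by apply/andP; split; lra.
have UA : \bigcup_n A n = `]a, b[%classic.
  apply/seteqP; split => x; first by move=> [n _]; exact: subA.
  rewrite /= in_itv/= => /andP[ax xb].
  have : \forall n \near \oo, h n < Num.min (x - a) (b - x).
    apply: (cvgr_lt _ hcvg); by rewrite lt_min !subr_gt0 ax.
  move=> [n _ /(_ n (leqnn n))]; rewrite /= lt_min => /andP[h1 h2].
  by exists n => //; rewrite /A/= in_itv/=; apply/andP; split; lra.
have ndA : {homo A : n m / (n <= m)%N >-> (n <= m)%O}.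
  move=> n m nm; apply/subsetPset => x; rewrite /A/= !in_itv/= => /andP[x1 x2].
  have : h m <= h n.
    rewrite ler_wpM2l ?divr_ge0 ?subr_ge0 ?(ltW ab)//.
    by rewrite /harmonic lef_pV2 ?posrE// ler_nat ltnS.
  by move=> hmn; apply/andP; split; lra.
have cvgA : (\int[mu]_(x in A i) (f x)%:E)%E @[i --> \oo] -->
    (\int[mu]_(x in `]a, b[) (f x)%:E)%E.
  rewrite -UA; apply: ge0_nondecreasing_set_cvg_integral => //.
  - by move=> i; exact: measurable_itv.
  - move=> i; apply/measurable_EFinP; apply: measurable_funS mf => //.
  - move=> i x /subA; rewrite /= in_itv/= => xab.
    by rewrite lee_fin f0.
have intA i : (\int[mu]_(x in A i) (f x)%:E = (F (b - h i) - F (a + h i))%:E)%E.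
  have ab' : a + h i < b - h i by have := h4 i; lra.
  have sub' : `[a + h i, b - h i] `<=` `]a, b[.
    move=> x; rewrite /= !in_itv/= => /andP[x1 x2]; have := h0 i.
    by move=> hi0; apply/andP; split; lra.
  have fi : mu.-integrable (A i) (EFin \o f).
    have : mu.-integrable `[a + h i, b - h i] (EFin \o f).
      apply: continuous_compact_integrable; first exact: segment_compact.
      apply: continuous_in_subspaceT => x; rewrite inE => /sub'.
      by rewrite /= in_itv/=; exact: cf.
    apply: (@integrableS _ _ _ mu); [exact: measurable_itv|exact: measurable_itv|].
    exact: subset_itv_oo_cc.
  have <- : \int[mu]_(x in A i) f x = F (b - h i) - F (a + h i).
    apply: FTC2_open => // x xab; [apply: dF|apply: cf];
      by have := @subA i x; rewrite /A/= !in_itv/=; apply.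
  by rewrite /Rintegral fineK//; apply: integrable_fin_num => //; exact: measurable_itv.
have cvgF : (F (b - h i) - F (a + h i))%:E @[i --> \oo] --> (F b - F a)%:E.
  apply: cvg_EFin; first exact: nearW.
  have hb : b - h i @[i --> \oo] --> b - 0.
    by apply: cvgB => //; exact: cvg_cst.
  have ha : a + h i @[i --> \oo] --> a + 0.
    by apply: cvgD => //; exact: cvg_cst.
  rewrite subr0 in hb; rewrite addr0 in ha.
  apply: cvgB.
    exact: (@continuous_cvg _ _ _ _ _ (fun i => b - h i) F b (cF b) hb).
  exact: (@continuous_cvg _ _ _ _ _ (fun i => a + h i) F a (cF a) ha).
have -> : (\int[mu]_(x in `]a, b[) `|(EFin \o f) x| =
    \int[mu]_(x in `]a, b[) (f x)%:E)%E.
  apply: eq_integral => x; rewrite inE/= in_itv/= => xab.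
  by rewrite ger0_norm// f0.
have cvgA' : (F (b - h i) - F (a + h i))%:E @[i --> \oo] -->
    (\int[mu]_(x in `]a, b[) (f x)%:E)%E.
  by apply: cvg_trans cvgA; apply: near_eq_cvg; exact: nearW.
rewrite (cvg_unique _ cvgA' cvgF) ?ltry//; exact: ereal_hausdorff.
Qed.

End ftc.

(** * Truncated powers *)

Section ppow.
Context {R : realType}.
Local Notation mu := (@lebesgue_measure R).
Implicit Types (a b u v r s t : R).

(** The power u_+^b of the positive part.  It differs from [powR] for u < 0, where
    [powR] takes the value 1, and vanishes at 0 even for b <= 0. *)
Definition ppow b u : R := if 0 < u then u `^ b else 0.

Lemma ppow_gt0E b u : 0 < u -> ppow b u = u `^ b.
Proof. by rewrite /ppow => ->. Qed.

Lemma ppow_le0E b u : u <= 0 -> ppow b u = 0.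
Proof. by rewrite /ppow ltNge => ->. Qed.

Lemma ppow_ge0 b u : 0 <= ppow b u.
Proof. by rewrite /ppow; case: ifPn => // _; exact: powR_ge0. Qed.

Lemma le_ppow b u v : 0 < b -> u <= v -> ppow b u <= ppow b v.
Proof.
move=> b0 uv; have [u0|u0] := leP u 0.
  by rewrite (ppow_le0E _ u0) ppow_ge0.
have v0 := lt_le_trans u0 uv.
by rewrite !ppow_gt0E// ge0_ler_powR ?nnegrE// ltW.
Qed.

Lemma is_derive_ppow b u : u != 0 ->
  is_derive u 1 (ppow b) (b * ppow (b - 1) u).
Proof.
rewrite neq_lt => /orP[u0|u0].
  rewrite (ppow_le0E _ (ltW u0)) mulr0.
  apply: (@near_eq_is_derive R R R (cst 0)).
  by near=> y; rewrite /= ppow_le0E// ltW//; near: y; exact: lt_nbhsl.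
rewrite ppow_gt0E//.
apply: near_eq_is_derive (is_derive1_powR b u0).
by near=> y; rewrite /= ppow_gt0E//; near: y; exact: lt_nbhsr.
Unshelve. all: by end_near. Qed.

Lemma continuous_at_ppow b u : u != 0 -> {for u, continuous (ppow b)}.
Proof.
move=> u0; apply: differentiable_continuous; apply/derivable1_diffP.
by have h := is_derive_ppow b u0; exact: ex_derive.
Qed.

Lemma continuous_ppow b : 0 < b -> continuous (ppow b).
Proof.
move=> b0 u; have [->|] := eqVneq u 0; last exact: continuous_at_ppow.
apply/left_right_continuousP; rewrite /= (ppow_le0E _ (lexx 0)); split.
  apply: (@cvg_trans _ (cst 0 @ 0^'-)); last exact: cvg_cst.
  apply: near_eq_cvg; near=> y; rewrite /= ppow_le0E//.
apply: cvg_trans (powR_cvg0 b0).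
apply: near_eq_cvg; near=> y; rewrite ppow_gt0E//.
Unshelve. all: by end_near. Qed.

Lemma measurable_ppow b : measurable_fun setT (ppow b).
Proof.
apply: measurable_fun_ifT => //.
exact: (@measurable_fun_ltr _ _ _ setT (cst 0) id).
Qed.

Lemma is_derive_ppowl b a t : t != a ->
  is_derive t 1 (fun s => ppow b (s - a)) (b * ppow (b - 1) (t - a)).
Proof.
move=> ta; rewrite -[X in is_derive _ _ _ X]mulr1.
apply: (@is_derive1_comp _ (ppow b) (fun s => s - a)).
  by apply: is_derive_ppow; rewrite subr_eq0.
by rewrite -[X in is_derive _ _ _ X]subr0; apply: is_deriveB.
Qed.

Lemma is_derive_ppowr b r t : t != r ->
  is_derive t 1 (fun s => ppow b (r - s)) (- (b * ppow (b - 1) (r - t))).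
Proof.
move=> tr; rewrite -[X in is_derive _ _ _ X]mulrN1.
apply: (@is_derive1_comp _ (ppow b) (fun s => r - s)).
  by apply: is_derive_ppow; rewrite subr_eq0 eq_sym.
by rewrite -[X in is_derive _ _ _ X]sub0r; apply: is_deriveB.
Qed.

Lemma continuous_at_ppowl b a t : {for t - a, continuous (ppow b)} ->
  {for t, continuous (fun s => ppow b (s - a))}.
Proof.
move=> cb; apply: (@continuous_comp _ _ _ (fun s => s - a) (ppow b)) => //.
by apply: cvgB; [exact: cvg_id|exact: cvg_cst].
Qed.

Lemma continuous_at_ppowr b r t : {for r - t, continuous (ppow b)} ->
  {for t, continuous (fun s => ppow b (r - s))}.
Proof.
move=> cb; apply: (@continuous_comp _ _ _ (fun s => r - s) (ppow b)) => //.
by apply: cvgB; [exact: cvg_cst|exact: cvg_id].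
Qed.

Lemma ppow_MVT b u v : 0 < b -> 0 <= u -> u < v ->
  exists2 w, u < w < v & ppow b v - ppow b u = b * ppow (b - 1) w * (v - u).
Proof.
move=> b0 u0 uv; have [|w|w] := @MVT _ (ppow b) (fun w => b * ppow (b - 1) w) _ _ uv.
- move=> x; rewrite in_itv/= => /andP[ux _]; apply: is_derive_ppow.
  by rewrite gt_eqF// (le_lt_trans u0).
- by apply: continuous_subspaceT; exact: continuous_ppow.
- by rewrite in_itv/= => wuv ?; exists w.
Qed.

Lemma integrable_ppowl b a r : 0 < b ->
  mu.-integrable `]a, r[ (EFin \o (fun s => ppow (b - 1) (s - a))).
Proof.
move=> b0; have [ra|ar] := leP r a.
  by rewrite set_itv_ge ?bnd_simp -?leNgt//; exact: integrable_set0.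
apply: (@FTC2_open_ge0 _ (fun s => b^-1 * ppow b (s - a))) => //.
- move=> s; apply: cvgMr.
  by apply: continuous_at_ppowl; exact: continuous_ppow.
- move=> x /andP[ax _].
  rewrite (_ : ppow (b - 1) _ = b^-1 * (b * ppow (b - 1) (x - a))).
    by apply: is_deriveZ; apply: is_derive_ppowl; rewrite gt_eqF.
  by rewrite mulKf// gt_eqF.
- by move=> x /andP[ax _]; apply: continuous_at_ppowl; apply: continuous_at_ppow;
    rewrite subr_eq0 gt_eqF.
- by move=> x _; exact: ppow_ge0.
Qed.

Lemma integrable_ppowr b a r : 0 < b ->
  mu.-integrable `]a, r[ (EFin \o (fun s => ppow (b - 1) (r - s))).
Proof.
move=> b0; have [ra|ar] := leP r a.
  by rewrite set_itv_ge ?bnd_simp -?leNgt//; exact: integrable_set0.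
apply: (@FTC2_open_ge0 _ (fun s => - (b^-1) * ppow b (r - s))) => //.
- move=> s; apply: cvgMr.
  by apply: continuous_at_ppowr; exact: continuous_ppow.
- move=> x /andP[_ xr].
  rewrite (_ : ppow (b - 1) _ = - b^-1 * - (b * ppow (b - 1) (r - x))).
    by apply: is_deriveZ; apply: is_derive_ppowr; rewrite lt_eqF.
  by rewrite mulrNN mulKf// gt_eqF.
- by move=> x /andP[_ xr]; apply: continuous_at_ppowr; apply: continuous_at_ppow;
    rewrite subr_eq0 gt_eqF.
- by move=> x _; exact: ppow_ge0.
Qed.

Lemma Rintegral_ppowr b c d t : 0 < b -> c <= d -> d <= t ->
  \int[mu]_(s in `]c, d[) ppow (b - 1) (t - s) =
  b^-1 * (ppow b (t - c) - ppow b (t - d)).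
Proof.
move=> b0; rewrite le_eqVlt => /predU1P[<- _|cd dt].
  by rewrite set_itv_ge ?bnd_simp ?ltxx// Rintegral_set0 subrr mulr0.
transitivity (- (b^-1) * ppow b (t - d) - - (b^-1) * ppow b (t - c)); last by ring.
apply: (@FTC2_open _ (fun s => - (b^-1) * ppow b (t - s))) => //.
- move=> s; apply: cvgMr.
  by apply: continuous_at_ppowr; exact: continuous_ppow.
- move=> x /andP[_ xr].
  rewrite (_ : ppow (b - 1) _ = - b^-1 * - (b * ppow (b - 1) (t - x))).
    apply: is_deriveZ; apply: is_derive_ppowr.
    by rewrite lt_eqF// (lt_le_trans xr).
  by rewrite mulrNN mulKf// gt_eqF.
- move=> x /andP[_ xr]; apply: continuous_at_ppowr.
  by apply: continuous_at_ppow; rewrite subr_eq0 gt_eqF// (lt_le_trans xr).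
- apply: integrableS (integrable_ppowr c t b0) => //.
  by apply: subset_itvl; rewrite bnd_simp.
Qed.

End ppow.

(** * Integration by parts against a test function *)

Section by_parts.
Context {R : realType}.
Local Notation mu := (@lebesgue_measure R).

Lemma time_test_derivable (T t : R) phi : time_test T phi ->
  is_derive t 1 phi (derive1 phi t).
Proof.
move=> [/(_ 0%N t) dphi _]; rewrite /derive1n/= in dphi.
by apply: DeriveDef => //; rewrite derive1E.
Qed.

Lemma time_test_continuous (T : R) phi : time_test T phi -> continuous phi.
Proof.
move=> [dphi _] t; apply: differentiable_continuous; apply/derivable1_diffP.
exact: (dphi 0%N).
Qed.

Lemma time_test_continuous_derive1 (T : R) phi :
  time_test T phi -> continuous (derive1 phi).
Proof.
move=> [dphi _] t; apply: differentiable_continuous; apply/derivable1_diffP.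
exact: (dphi 1%N).
Qed.

Lemma time_testT (T : R) phi : time_test T phi -> phi T = 0.
Proof.
move=> [_ [a [b [_ bT phi0]]]]; apply: phi0.
by rewrite negb_and -!ltNge bT orbT.
Qed.

Lemma continuous_bounded_itv (f : R -> R) (a b : R) : continuous f ->
  exists M : R, forall t, a <= t <= b -> `|f t| <= M.
Proof.
move=> cf; have : compact (f @` `[a, b]).
  apply: continuous_compact; last exact: segment_compact.
  exact: continuous_subspaceT.
move=> /compact_bounded[M [_ /(_ (M + 1))]]; rewrite ltrDl ltr01 => /(_ isT) H.
by exists (M + 1) => t tab; apply: H; exists t.
Qed.

Lemma integrable_continuous_itv (f : R -> R) (a b : R) : continuous f ->
  mu.-integrable `]a, b[ (EFin \o f).
Proof.
move=> cf; have : mu.-integrable `[a, b] (EFin \o f).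
  apply: continuous_compact_integrable; first exact: segment_compact.
  exact: continuous_subspaceT.
apply: integrableS; [exact: measurable_itv|exact: measurable_itv|].
exact: subset_itv_oo_cc.
Qed.

Lemma integrable_ppowlM (b a T : R) (h : R -> R) : 0 < b -> 0 <= a ->
  continuous h ->
  mu.-integrable `]0, T[ (EFin \o (fun t => ppow (b - 1) (t - a) * h t)).
Proof.
move=> b0 a0 ch.
have [M hM] := continuous_bounded_itv 0 T ch.
apply: (@integrableRM_bounded _ _ R mu `]0, T[%classic (fun t => ppow (b - 1) (t - a)) h M).
- exact: measurable_itv.
- apply: (@integrable_support _ _ R mu `]a, T[%classic);
    [exact: measurable_itv|exact: measurable_itv| | |exact: integrable_ppowl].
    by apply: subset_itvr; rewrite bnd_simp.
  move=> x; rewrite /= !in_itv/= => /andP[x0 xT] /negP.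
  by rewrite xT andbT -leNgt => xa; rewrite ppow_le0E// subr_le0.
- by apply: measurable_funTS; exact: continuous_measurable_fun.
- move=> x; rewrite /= in_itv/= => /andP[x0 xT].
  by apply: hM; rewrite !ltW.
Qed.

(** For b < 1 the derivative of (t - a)_+^b blows up at a, inside the interval, so
    the fundamental theorem is applied on ]a, T[ only, to the product of the two
    functions.  No boundary term appears: the power vanishes at a, phi at T. *)
Lemma by_parts (b a T : R) phi : 0 < b -> 0 <= a -> time_test T phi ->
  \int[mu]_(t in `]0, T[) (ppow b (t - a) * derive1 phi t) =
  - (b * \int[mu]_(t in `]0, T[) (ppow (b - 1) (t - a) * phi t)).
Proof.
move=> b0 a0 tphi.
have cphi := time_test_continuous tphi.
have cdphi := time_test_continuous_derive1 tphi.
have cpow : continuous (fun t => ppow b (t - a)).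
  by move=> t; apply: continuous_at_ppowl; exact: continuous_ppow.
have int1 : mu.-integrable `]0, T[ (EFin \o (fun t => ppow b (t - a) * derive1 phi t)).
  by apply: integrable_continuous_itv => t; apply: cvgM; [exact: cpow|exact: cdphi].
have int2 : mu.-integrable `]0, T[
    (EFin \o (fun t => b * (ppow (b - 1) (t - a) * phi t))).
  by apply: integrableRZ; [exact: measurable_itv|exact: integrable_ppowlM].
apply/eqP; rewrite -addr_eq0 -RintegralZl; last 2 first.
- exact: measurable_itv.
- exact: integrable_ppowlM.
rewrite -RintegralD; last 3 first.
- exact: measurable_itv.
- exact: int1.
- exact: int2.
rewrite (@Rintegral_support _ _ R mu `]a, T[%classic); last 2 first.
- by apply: subset_itvr; rewrite bnd_simp.
- move=> x; rewrite /= !in_itv/= => /andP[x0 xT] /negP.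
  rewrite xT andbT -leNgt => xa.
  by rewrite !ppow_le0E ?subr_le0// !mul0r mulr0 addr0.
have [Ta|aT] := leP T a.
  by rewrite set_itv_ge ?Rintegral_set0// bnd_simp -leNgt.
apply/eqP; transitivity (ppow b (T - a) * phi T - ppow b (a - a) * phi a).
  apply: (@FTC2_open _ (fun t => ppow b (t - a) * phi t)) => //.
  - by move=> t; apply: cvgM; [exact: cpow|exact: cphi].
  - move=> x /andP[ax xT].
    have d1 : is_derive x 1 (fun t => ppow b (t - a)) (b * ppow (b - 1) (x - a)).
      by apply: is_derive_ppowl; rewrite gt_eqF.
    have d2 := time_test_derivable x tphi.
    rewrite (_ : _ + _ = (ppow b (x - a)) *: derive1 phi x +
      phi x *: (b * ppow (b - 1) (x - a))); last by rewrite /GRing.scale/=; ring.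
    exact: is_deriveM.
  - move=> x /andP[ax xT]; apply: cvgD.
      by apply: cvgM; [exact: cpow|exact: cdphi].
    apply: cvgMr; apply: cvgM; last exact: cphi.
    apply: continuous_at_ppowl; apply: continuous_at_ppow.
    by rewrite subr_eq0 gt_eqF.
  - have : mu.-integrable `]0, T[ (EFin \o (fun t => ppow b (t - a) * derive1 phi t +
        b * (ppow (b - 1) (t - a) * phi t))).
      by apply: integrableRD => //; exact: measurable_itv.
    apply: integrableS; [exact: measurable_itv|exact: measurable_itv|].
    by apply: subset_itvr; rewrite bnd_simp.
by rewrite subrr (time_testT tphi) (ppow_le0E b (lexx 0)) mul0r mulr0 subrr.
Qed.

End by_parts.

(** * Smooth compactly supported approximations of a truncated power *)

Section cutoff.
Context {R : realType}.
Implicit Types (m a b u r t eta : R).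

(** The function u^a exp(- m / u) for u > 0, extended by 0.  For m > 0 its
    derivatives are combinations of functions of the same form, so it is smooth
    at 0. *)
Definition flat_pow m a u : R := if 0 < u then expR (a * ln u - m / u) else 0.

Lemma flat_pow_le0E m a u : u <= 0 -> flat_pow m a u = 0.
Proof. by rewrite /flat_pow ltNge => ->. Qed.

Lemma flat_pow_gt0E m a u : 0 < u -> flat_pow m a u = expR (a * ln u - m / u).
Proof. by rewrite /flat_pow => ->. Qed.

Lemma flat_pow_ge0 m a u : 0 <= flat_pow m a u.
Proof. by rewrite /flat_pow; case: ifPn => // _; exact: expR_ge0. Qed.

Lemma ln_le_sub1 u : 0 < u -> ln u <= u - 1.
Proof.
by move=> u0; rewrite -[in leLHS](subrKC 1 u); apply: le_ln1Dx; lra.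
Qed.

(** exp(- m / u) beats any power of u at 0.  Only the order u^2 is needed: it
    forces the derivative at 0 to vanish. *)
Lemma flat_pow_quadratic m a : 0 < m ->
  exists2 C, 0 < C & forall u, u <= 1 -> flat_pow m a u <= C * u ^+ 2.
Proof.
move=> m0; pose K := `|2 - a| + 1.
have K0 : 0 < K by rewrite ltr_wpDl.
exists (expR (K * ln (K / m))) => [|u u1]; first exact: expR_gt0.
have [u0|u0] := leP u 0.
  by rewrite flat_pow_le0E// mulr_ge0 ?expR_ge0 ?sqr_ge0.
rewrite flat_pow_gt0E//.
have -> : u ^+ 2 = expR (2 * ln u) by rewrite mulrC expRM_natr lnK.
rewrite -expRD ler_expR.
have lnu : ln u <= 0 by apply: ln_le0.
have h1 : (a - 2) * ln u <= K * - ln u.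
  rewrite -mulrNN opprB ler_wpM2r ?oppr_ge0// /K (le_trans (ler_norm _))//.
  by rewrite lerDl.
have h2 : K * - ln u <= K * ln (K / m) + m / u.
  (* ln y <= y - 1 at y = m / (K u) bounds - K ln u by m / u + constant *)
  have y0 : 0 < m / K / u by rewrite !divr_gt0.
  have := ln_le_sub1 y0.
  rewrite lnM ?posrE ?invr_gt0 ?divr_gt0// lnV ?posrE//.
  rewrite lnM ?posrE ?invr_gt0// lnV ?posrE// => h.
  rewrite lnM ?posrE ?invr_gt0// lnV ?posrE//.
  have : K * (ln m - ln K - ln u) <= K * (m / K / u - 1) by rewrite ler_pM2l.
  have -> : K * (m / K / u - 1) = m / u - K.
    by field; rewrite !gt_eqF.
  by move=> h'; lra.
by rewrite mulrBl in h1; lra.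
Qed.

Lemma is_derive_flat_pow m a u : 0 < m ->
  is_derive u 1 (flat_pow m a) (a * flat_pow m (a - 1) u + m * flat_pow m (a - 2) u).
Proof.
move=> m0; have [u0|u0|->] := ltgtP u 0.
- rewrite !flat_pow_le0E ?ltW// !mulr0 addr0.
  apply: (@near_eq_is_derive R R R (cst 0)).
  by near=> y; rewrite /= flat_pow_le0E// ltW//; near: y; exact: lt_nbhsl.
- have h : is_derive u 1 (fun y => expR (a * ln y - m * y^-1))
      (expR (a * ln u - m / u) * (a * u^-1 - m * (- u ^- 2))).
    apply: (@is_derive1_comp _ expR (fun y => a * ln y - m * y^-1)).
    apply: is_deriveB.
      by apply: is_deriveZ; exact: is_derive1_ln.
    apply: is_deriveZ.
    have -> : - u ^- 2 = - u ^- 2 *: 1 by rewrite /GRing.scale/= mulr1.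
    by apply: is_deriveV; rewrite gt_eqF.
  have e1 : flat_pow m (a - 1) u = expR (a * ln u - m / u) * u^-1.
    by rewrite flat_pow_gt0E// mulrBl mul1r addrAC expRB lnK ?posrE.
  have e2 : flat_pow m (a - 2) u = expR (a * ln u - m / u) * u^-2.
    rewrite flat_pow_gt0E// mulrBl addrAC expRB; congr (_ / _).
    by rewrite mulrC expRM_natr lnK ?posrE.
  have -> : a * flat_pow m (a - 1) u + m * flat_pow m (a - 2) u =
    expR (a * ln u - m / u) * (a * u^-1 - m * (- u ^- 2)) by rewrite e1 e2; ring.
  apply: near_eq_is_derive h.
  by near=> y; rewrite /= flat_pow_gt0E//; near: y; exact: lt_nbhsr.
- rewrite !(flat_pow_le0E _ _ (lexx 0)) !mulr0 addr0.
  have [C C0 HC] := flat_pow_quadratic a m0.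
  have L : h^-1 *: (flat_pow m a (h *: 1 + 0) - flat_pow m a 0) @[h --> 0^'] --> (0 : R).
    apply/cvgrPdist_le => /= e e0.
    have eC : 0 < e / C by rewrite divr_gt0.
    near=> h.
    have h0 : h != 0 by near: h; exact: nbhs_dnbhs_neq.
    have hh : `|h| <= Num.min 1 (e / C).
      near: h; apply: dnbhs0_le; by rewrite lt_min ltr01.
    move: hh; rewrite le_min => /andP[h1 h2].
    rewrite (flat_pow_le0E _ _ (lexx 0)) subr0 sub0r normrN addr0.
    rewrite /GRing.scale/= mulr1 normrM normfV ler_pdivrMl ?normr_gt0//.
    rewrite ger0_norm ?flat_pow_ge0//.
    apply: (le_trans (HC h (le_trans (ler_norm _) h1))).
    rewrite -real_normK ?num_real// expr2 mulrCA ler_wpM2l//.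
    by rewrite mulrC -ler_pdivlMr.
  by apply: DeriveDef; [apply: cvgP L|apply: cvg_lim L].
Unshelve. all: by end_near. Qed.

(** The list of triples (coefficient, left exponent, right exponent) describes a
    linear combination of products of two flat powers, one vanishing to the left
    of x and one to the right of y.  This class is closed under differentiation,
    which acts on lists by [flat_prod_derive]. *)
Definition flat_prod m (l : seq (R * R * R)) (x y t : R) : R :=
  \sum_(p <- l) p.1.1 * (flat_pow m p.1.2 (t - x) * flat_pow m p.2 (y - t)).

Definition flat_prod_derive m (l : seq (R * R * R)) : seq (R * R * R) :=
  flatten [seq [:: (p.1.1 * p.1.2, p.1.2 - 1, p.2); (p.1.1 * m, p.1.2 - 2, p.2);
                   (- (p.1.1 * p.2), p.1.2, p.2 - 1);
                   (- (p.1.1 * m), p.1.2, p.2 - 2)] | p <- l].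

Lemma is_derive_flat_prod m l x y t : 0 < m ->
  is_derive t 1 (flat_prod m l x y) (flat_prod m (flat_prod_derive m l) x y t).
Proof.
move=> m0; elim: l => [|[[c a] b] l IH].
  rewrite (_ : flat_prod m [::] x y = cst 0); last first.
    by apply/funext => s; rewrite /flat_prod big_nil.
  exact: is_derive_cst.
have d1 : is_derive t 1 (fun s => flat_pow m a (s - x))
    (a * flat_pow m (a - 1) (t - x) + m * flat_pow m (a - 2) (t - x)).
  rewrite -[X in is_derive _ _ _ X]mulr1.
  apply: (@is_derive1_comp _ (flat_pow m a) (fun s => s - x)).
    exact: is_derive_flat_pow.
  by rewrite -[X in is_derive _ _ _ X]subr0; apply: is_deriveB.
have d2 : is_derive t 1 (fun s => flat_pow m b (y - s))
    (- (b * flat_pow m (b - 1) (y - t) + m * flat_pow m (b - 2) (y - t))).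
  rewrite -[X in is_derive _ _ _ X]mulrN1.
  apply: (@is_derive1_comp _ (flat_pow m b) (fun s => y - s)).
    exact: is_derive_flat_pow.
  by rewrite -[X in is_derive _ _ _ X]sub0r; apply: is_deriveB.
have d3 := is_deriveM d1 d2.
have d4 := is_deriveD (is_deriveZ c d3) IH.
have -> : flat_prod m ((c, a, b) :: l) x y =
    c *: ((fun s => flat_pow m a (s - x)) * (fun s => flat_pow m b (y - s))) +
    flat_prod m l x y.
  by apply/funext => s; rewrite /flat_prod big_cons.
have -> : flat_prod m (flat_prod_derive m ((c, a, b) :: l)) x y t =
  c *: (flat_pow m a (t - x) *: - (b * flat_pow m (b - 1) (y - t) +
      m * flat_pow m (b - 2) (y - t)) +
    flat_pow m b (y - t) *: (a * flat_pow m (a - 1) (t - x) +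
      m * flat_pow m (a - 2) (t - x))) + flat_prod m (flat_prod_derive m l) x y t.
  by rewrite /flat_prod /flat_prod_derive/= !big_cons/= /GRing.scale/=; ring.
exact: d4.
Qed.

Lemma derive1n_flat_prod m l x y n : 0 < m ->
  derive1n n (flat_prod m l x y) = flat_prod m (iter n (flat_prod_derive m) l) x y.
Proof.
move=> m0; elim: n => [//|n IH]; rewrite derive1nS IH.
apply/funext => t; rewrite derive1E iterS.
have h := is_derive_flat_prod (iter n (flat_prod_derive m) l) x y t m0.
exact: derive_val.
Qed.

(** A smooth approximation of (r - t)_+^g on t > 0.  The same vanishing parameter
    serves as flatness and as distance from the support to 0 and r, so the support
    is a compact subset of ]0, r[. *)
Definition cutoff_ppow g r (n : nat) : R -> R :=
  flat_prod (harmonic n) [:: (1, 0, g)] (harmonic n) (r - harmonic n).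

Lemma cutoff_ppowE g r n t : cutoff_ppow g r n t =
  flat_pow (harmonic n) 0 (t - harmonic n) *
  flat_pow (harmonic n) g (r - harmonic n - t).
Proof. by rewrite /cutoff_ppow /flat_prod big_seq1 mul1r. Qed.

Lemma time_test_cutoff_ppow g r T n : r <= T -> time_test T (cutoff_ppow g r n).
Proof.
move=> rT; have h0 : 0 < harmonic n :> R by rewrite invr_gt0.
split.
  move=> k t; rewrite derive1n_flat_prod//.
  have h := is_derive_flat_prod (iter k (flat_prod_derive (harmonic n))
    [:: (1, 0, g)]) (harmonic n) (r - harmonic n) t h0.
  exact: ex_derive.
exists (harmonic n), (r - harmonic n); split => //.
  by lra.
move=> t; rewrite negb_and -!ltNge cutoff_ppowE => /orP[th|th].
  by rewrite flat_pow_le0E ?mul0r// subr_le0 ltW.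
by rewrite (@flat_pow_le0E _ _ (r - _ - _)) ?mulr0// subr_le0 ltW.
Qed.

Lemma cutoff_ppow_le g r n t : 0 < g -> 0 <= t ->
  `|cutoff_ppow g r n t| <= ppow g r.
Proof.
move=> g0 t0; have h0 : 0 < harmonic n :> R by rewrite invr_gt0.
rewrite cutoff_ppowE ger0_norm; last by rewrite mulr_ge0// flat_pow_ge0.
have e1 u : flat_pow (harmonic n) 0 u <= 1.
  rewrite /flat_pow; case: ifPn => // u0.
  by rewrite mul0r sub0r -expR0 ler_expR oppr_le0 divr_ge0 ?ltW.
have e2 u : flat_pow (harmonic n) g u <= ppow g u.
  rewrite /flat_pow /ppow; case: ifPn => // u0.
  by rewrite /powR gt_eqF// ler_expR lerBlDr lerDl divr_ge0 ?ltW.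
apply: (@le_trans _ _ (1 * ppow g (r - harmonic n - t))).
  by apply: ler_pM; rewrite ?flat_pow_ge0.
by rewrite mul1r le_ppow//; lra.
Qed.

Lemma cutoff_ppow_cvg g r t : 0 < t ->
  cutoff_ppow g r n t @[n --> \oo] --> ppow g (r - t).
Proof.
move=> t0; have h0 n : 0 < harmonic n :> R by rewrite invr_gt0.
have hcvg := @cvg_harmonic R.
have [rt|tr] := leP r t.
  rewrite ppow_le0E ?subr_le0//; apply: cvg_near_cst.
  apply: nearW => n; rewrite cutoff_ppowE.
  rewrite (@flat_pow_le0E _ _ (r - _ - _)) ?mulr0//.
  by have := h0 n; lra.
have c0 (u : R) : u - harmonic n @[n --> \oo] --> u.
  have : u - harmonic n @[n --> \oo] --> u - 0.
    by apply: cvgB => //; exact: cvg_cst.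
  by rewrite subr0.
have c1 := c0 t.
have c2 : r - harmonic n - t @[n --> \oo] --> r - t.
  by apply: cvgB => //; exact: cvg_cst.
have rt0 : 0 < r - t by rewrite subr_gt0.
have d1 : harmonic n / (t - harmonic n) @[n --> \oo] --> 0 / t.
  by apply: cvgM => //; apply: cvgV => //; rewrite gt_eqF.
have d2 : harmonic n / (r - harmonic n - t) @[n --> \oo] --> 0 / (r - t).
  by apply: cvgM => //; apply: cvgV => //; rewrite gt_eqF.
have d3 : ln (r - harmonic n - t) @[n --> \oo] --> ln (r - t).
  by apply: continuous_cvg => //; exact: continuous_ln.
have -> : ppow g (r - t) = expR (0 * ln t - 0 / t) *
    expR (g * ln (r - t) - 0 / (r - t)).
  by rewrite !mul0r !subr0 expR0 mul1r ppow_gt0E// /powR gt_eqF.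
have K : expR (0 * ln (t - harmonic n) - harmonic n / (t - harmonic n)) *
   expR (g * ln (r - harmonic n - t) - harmonic n / (r - harmonic n - t))
   @[n --> \oo] --> expR (0 * ln t - 0 / t) * expR (g * ln (r - t) - 0 / (r - t)).
  apply: cvgM.
    apply: continuous_cvg; first exact: continuous_expR.
    apply: cvgB => //; rewrite mul0r.
    by under eq_fun do rewrite mul0r; exact: cvg_cst.
  apply: continuous_cvg; first exact: continuous_expR.
  by apply: cvgB => //; apply: cvgMr; exact: d3.
apply: cvg_trans K; apply: near_eq_cvg; near=> n.
rewrite cutoff_ppowE !flat_pow_gt0E//.
  by near: n; exact: (cvgr_gt _ c2).
by near: n; exact: (cvgr_gt _ c1).
Unshelve. all: by end_near. Qed.

End cutoff.

(** * The Beta integral and the Gamma function *)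

Section constants.
Context {R : realType}.
Local Notation mu := (@lebesgue_measure R).

Section affine.
Variables (l a : R) (l0 : 0 < l).
Let phi : measurableTypeR R -> measurableTypeR R := fun u => l * u + a.

Let mphi : measurable_fun setT phi.
Proof.
apply: continuous_measurable_fun => u.
by apply: cvgD; [apply: cvgMr; exact: cvg_id|exact: cvg_cst].
Qed.

Let nu : {measure set (measurableTypeR R) -> \bar R}.
Proof. by refine (pushforward mu phi : {measure set (measurableTypeR R) -> \bar R}). Defined.

(** Compared on half-open intervals, which determine a sigma-finite measure. *)
Lemma lebesgue_measure_affine A : measurable A ->
  mu A = mscale (NngNum (ltW l0)) nu A.
Proof.
move=> mA; apply: lebesgue_measure_unique => //= _ [[c e]] _ <-.
rewrite /mscale/= /nu/= /pushforward.
have -> : phi @^-1` `]c, e] = `](c - a) / l, (e - a) / l]%classic.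
  apply/seteqP; split => u; rewrite /= !in_itv/= /phi => /andP[h1 h2];
    rewrite ?ltr_pdivrMr ?ler_pdivlMr// in h1 h2 *; apply/andP; split; lra.
rewrite !lebesgue_measure_itv/= !lte_fin ltr_pM2r ?invr_gt0// ltrD2r.
case: ifPn => _; last by rewrite mule0.
rewrite -!EFinB -EFinM; congr EFin; field.
by rewrite gt_eqF.
Qed.

Lemma ge0_integral_affine (D : set (measurableTypeR R))
    (f : measurableTypeR R -> R) : measurable D -> measurable_fun D f ->
  (forall x, D x -> 0 <= f x) ->
  (\int[mu]_(x in D) (f x)%:E =
   l%:E * \int[mu]_(u in [set u | D (l * u + a)%R]) (f (l * u + a)%R)%:E)%E.
Proof.
move=> mD mf f0.
rewrite (@eq_measure_integral _ _ _ D (mscale (NngNum (ltW l0)) nu)); last first.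
  by move=> A mA _; exact: lebesgue_measure_affine.
rewrite ge0_integral_mscale//; last exact/measurable_EFinP.
congr (_ * _)%E.
rewrite (@ge0_integral_pushforward _ _ _ _ _ _ mphi)//.
  exact/measurable_EFinP.
by move=> y; rewrite inE => Dy; rewrite lee_fin f0.
Qed.

End affine.

(** The value B(1 - g, 1 + g) of Euler's Beta function. *)
Definition Rbeta (g : R) : R :=
  \int[mu]_(u in `]0, 1[) (ppow (- g) u * ppow g (1 - u)).

Lemma integrable_beta (g : R) : 0 < g < 1 ->
  mu.-integrable `]0, 1[ (EFin \o (fun u => ppow (- g) u * ppow g (1 - u))).
Proof.
move=> /andP[g0 g1]; have b0 : 0 < 1 - g by rewrite subr_gt0.
have cg : continuous (fun u : R => ppow g (1 - u)).
  by move=> u; apply: continuous_at_ppowr; exact: continuous_ppow.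
have := @integrable_ppowlM R (1 - g) 0 1 _ b0 (lexx _) cg.
apply: eq_integrable; first exact: measurable_itv.
by move=> u _ /=; rewrite subr0 (_ : 1 - g - 1 = - g)//; ring.
Qed.

Lemma Rbeta_gt0 (g : R) : 0 < g < 1 -> 0 < Rbeta g.
Proof.
move=> g01; have /andP[g0 g1] := g01.
have i2 : mu.-integrable `]0, 1[ (EFin \o (fun u : R => ppow (2 - 1) (1 - u))).
  by apply: integrable_ppowr; lra.
apply: (@lt_le_trans _ _ (\int[mu]_(u in `]0, 1[) ppow (2 - 1) (1 - u))).
  rewrite Rintegral_ppowr// subrr (ppow_le0E _ (lexx 0)) !subr0.
  by rewrite ppow_gt0E// powR1 mulr1 invr_gt0.
apply: le_Rintegral => //; [exact: integrable_beta|] => u.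
rewrite /= in_itv/= => /andP[u0 u1].
have u10 : 0 < 1 - u by rewrite subr_gt0.
rewrite !ppow_gt0E// (_ : 2 - 1 = 1); last by ring.
rewrite powRr1 ?(ltW u10)// -[leLHS]mul1r.
apply: ler_pM => //; first by rewrite ltW.
  rewrite powRN invf_ge1 ?powR_gt0//.
  have := @ge0_ler_powR R g (ltW g0) u 1; rewrite powR1 !nnegrE; apply => //.
    by rewrite ltW.
  by rewrite ltW.
by apply: ger1_powR; [apply/andP; split=> //; lra|exact: ltW].
Qed.

(** The exponents - g and g add up to 0, so rescaling to the unit interval leaves
    only the factor r - a.  This linearity is what turns the fractional integral of
    a step function back into its plain integral. *)
Lemma beta_integral (g a r : R) : 0 < g < 1 -> a <= r ->
  \int[mu]_(s in `]a, r[) (ppow (- g) (s - a) * ppow g (r - s)) = (r - a) * Rbeta g.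
Proof.
move=> g01; rewrite le_eqVlt => /predU1P[<-|ar].
  by rewrite set_itv_ge ?bnd_simp ?ltxx// Rintegral_set0 subrr mul0r.
have ra0 : 0 < r - a by rewrite subr_gt0.
rewrite /Rintegral (@ge0_integral_affine (r - a) a ra0); last 3 first.
- exact: measurable_itv.
- apply: measurable_funTS; apply: measurable_funM.
    apply: measurableT_comp; first exact: measurable_ppow.
    exact: measurable_funB.
  apply: measurableT_comp; first exact: measurable_ppow.
  exact: measurable_funB.
- by move=> x _; rewrite mulr_ge0// ppow_ge0.
have -> : [set u | `]a, r[%classic ((r - a) * u + a)] = `]0, 1[%classic.
  apply/seteqP; split => u; rewrite /= !in_itv/= => /andP[h1 h2].
    rewrite ltrDr pmulr_rgt0// in h1; rewrite h1/=.
    by rewrite -ltrBrDr -[ltRHS]mulr1 ltr_pM2l// in h2.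
  by rewrite ltrDr mulr_gt0//= -ltrBrDr -[ltRHS]mulr1 ltr_pM2l.
have finB : (\int[mu]_(u in `]0%R, 1%R[) (ppow (- g) u * ppow g (1 - u))%:E)%E \is a fin_num.
  by apply: integrable_fin_num; [exact: measurable_itv|exact: integrable_beta].
rewrite -[r - a in RHS]/(fine (r - a)%:E) -fineM; [|by []|exact: finB].
congr (fine (_ * _)%E); apply: eq_integral => u.
rewrite inE/= in_itv/= => /andP[u0 u1]; congr EFin.
rewrite addrK (_ : r - ((r - a) * u + a) = (r - a) * (1 - u)); last by ring.
have u10 : 0 < 1 - u by rewrite subr_gt0.
have e1 : ppow (- g) ((r - a) * u) = (r - a) `^ (- g) * ppow (- g) u.
  by rewrite !ppow_gt0E ?mulr_gt0// powRM ?ltW.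
have e2 : ppow g ((r - a) * (1 - u)) = (r - a) `^ g * ppow g (1 - u).
  by rewrite !ppow_gt0E ?mulr_gt0// powRM ?ltW.
have e3 : (r - a) `^ (- g) * (r - a) `^ g = 1.
  by rewrite powRN mulVf// gt_eqF// powR_gt0.
by rewrite e1 e2 mulrACA e3 mul1r.
Qed.

End constants.

Section gamma.
Context {R : realType}.
Local Notation mu := (@lebesgue_measure R).

Lemma integrable_expRN :
  mu.-integrable `]0, +oo[ (EFin \o (fun t : R => expR (- t))).
Proof.
have : mu.-integrable `]0, +oo[ (EFin \o exponential_pdf (1 : R)).
  apply: (@integrableS _ _ R mu setT) => //.
  exact: integrable_exponential_pdf.
apply: eq_integrable; first exact: measurable_itv.
move=> t; rewrite inE/= in_itv/= andbT => t0.
by rewrite /= exponential_pdfE ?ltW// mulN1r mul1r.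
Qed.

(** t^(z - 1) dominates near 0, and exp(- t) beyond 1, where t^(z - 1) <= 1. *)
Lemma integrable_Gamma (z : R) : 0 < z <= 1 ->
  mu.-integrable `]0, +oo[ (EFin \o (fun t => t `^ (z - 1) * expR (- t))).
Proof.
move=> /andP[z0 z1].
apply: (@le_integrableR _ _ R mu `]0, +oo[%classic _
  (fun t => (ppow (z - 1) \_ `]0, 1[) t + expR (- t))).
- exact: measurable_itv.
- apply: measurable_funTS; apply: measurable_funM; first exact: measurable_powR.
  by apply: measurableT_comp => //; exact: measurable_expR.
- move=> t; rewrite /= in_itv/= andbT => t0.
  rewrite ger0_norm ?mulr_ge0 ?powR_ge0 ?expR_ge0//.
  have e1 : expR (- t) <= 1 by rewrite -expR0 ler_expR oppr_le0 ltW.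
  have [t1|t1] := ltP t 1.
    rewrite patchE mem_set/=; last by rewrite in_itv/= t0.
    rewrite ppow_gt0E// -[leLHS]addr0 lerD ?expR_ge0//.
    by rewrite -[leRHS]mulr1 ler_wpM2l ?powR_ge0.
  rewrite patchE memNset ?add0r; last first.
    by rewrite /= in_itv/= => /andP[_]; rewrite ltNge t1.
  rewrite -[leRHS]mul1r ler_wpM2r ?expR_ge0//.
  by rewrite -[leRHS](powRr0 t) ler_powR// subr_le0.
- apply: integrableRD; [exact: measurable_itv| |exact: integrable_expRN].
  apply: (@integrable_support _ _ R mu `]0, 1[%classic);
    [exact: measurable_itv|exact: measurable_itv| | |].
  + by apply: subset_itvl.
  + by move=> x _ x1; rewrite patchE memNset.
  + have := @integrable_ppowl R z 0 1 z0.
    apply: eq_integrable; first exact: measurable_itv.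
    by move=> x xi /=; rewrite patchE xi subr0.
Qed.

(** [Gamma] is defined by an integral with values in R, which would be 0 if the
    improper integral diverged; positivity therefore uses integrability. *)
Lemma Gamma_gt0 (z : R) : 0 < z <= 1 -> 0 < Gamma z.
Proof.
move=> z01; have /andP[z0 z1] := z01.
pose f := fun t : R => t `^ (z - 1) * expR (- t).
have intf := integrable_Gamma z01.
have sub : (`]0, 1[%classic : set R) `<=` `]0, +oo[%classic by apply: subset_itvl.
apply: (@lt_le_trans _ _ (expR (-1))); first exact: expR_gt0.
apply: (@le_trans _ _ (\int[mu]_(t in `]0, 1[) expR (-1))).
  rewrite Rintegral_cst//; set m := (X in fine X).
  have -> : m = 1%E.
    by have := @lebesgue_measure_itv R `]0, 1[; rewrite /= lte_fin ltr01 oppr0 adde0; apply.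
  by rewrite mulr1.
apply: (@le_trans _ _ (\int[mu]_(t in `]0, 1[) f t)).
  apply: le_Rintegral => //.
  - by apply: integrable_continuous_itv; exact: cst_continuous.
  - by apply: integrableS intf.
  - move=> t; rewrite /= in_itv/= => /andP[t0 t1].
    rewrite -[leLHS]mul1r; apply: ler_pM => //; rewrite ?expR_ge0//.
      rewrite -[leLHS](powRr0 t); apply: ger_powR; first by rewrite t0 ltW.
      by rewrite lerBlDr add0r.
    by rewrite ler_expR lerN2 ltW.
apply: fine_le.
- by apply: integrable_fin_num => //; apply: integrableS intf.
- by apply: integrable_fin_num => //; exact: measurable_itv.
- apply: ge0_subset_integral => //.
  + by case/integrableP: intf.
  + by move=> x _; rewrite lee_fin mulr_ge0 ?powR_ge0 ?expR_ge0.
Qed.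

End gamma.

(** * The Riemann-Liouville integral of a step function *)

Section node.
Context {R : realType}.
Local Notation mu := (@lebesgue_measure R).

Lemma Rintegral_comb D n (c : 'I_n -> R) (F : 'I_n -> R -> R) (w : R -> R) :
  measurable D ->
  (forall i, mu.-integrable D (EFin \o (fun t => F i t * w t))) ->
  \int[mu]_(t in D) ((\sum_(i < n) c i * F i t) * w t) =
  \sum_(i < n) c i * \int[mu]_(t in D) (F i t * w t).
Proof.
move=> mD intF; transitivity (\int[mu]_(t in D) (\sum_(i < n) c i * (F i t * w t))).
  by apply: eq_Rintegral => t _; rewrite mulr_suml; apply: eq_bigr => i _; rewrite mulrA.
rewrite Rintegral_sum//.
  by apply: eq_bigr => i _; rewrite RintegralZl.
by move=> i; exact: integrableRZ.
Qed.

(** When t lies inside ]c, d[ the domain is cut at t, where the second power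
    vanishes, and when t <= c both sides are 0. *)
Lemma RL_kernel_slab (b c d t : R) : 0 < b -> 0 <= c <= d -> 0 < t ->
  \int[mu]_(s in `]0, t[ `&` `]c, d[) ppow (b - 1) (t - s) =
  b^-1 * (ppow b (t - c) - ppow b (t - d)).
Proof.
move=> b0 /andP[c0 cd] t0; have [tc|ct] := ltP t c.
  rewrite !ppow_le0E ?subr_le0 ?(ltW tc)//; last by rewrite (le_trans (ltW tc)).
  rewrite subrr mulr0 (_ : _ `&` _ = set0) ?Rintegral_set0//.
  rewrite -subset0 => s [/=]; rewrite !in_itv/= => /andP[_ st] /andP[cs _].
  by have := lt_trans st (lt_trans tc cs); rewrite ltxx.
have -> : `]0, t[ `&` `]c, d[ = `]c, (Num.min d t)[%classic.
  apply/seteqP; split => s; rewrite /= !in_itv/= lt_min.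
    by move=> [/andP[s0 ->] /andP[-> ->]].
  by move=> /and3P[cs -> ->]; rewrite cs (le_lt_trans c0 cs).
have [dt|td] := leP d t; first by rewrite Rintegral_ppowr.
rewrite Rintegral_ppowr// subrr (ppow_le0E _ (lexx 0)).
by rewrite (@ppow_le0E _ _ (t - d))// subr_le0 ltW.
Qed.

Section step_function.
Variables (J : nat) (T : R) (t : nat -> R) (v : R -> R) (c : nat -> R).
Hypotheses (t0 : t 0%N = 0) (tJ : t J = T)
  (tnd : forall i, (i < J)%N -> t i < t i.+1)
  (mv : measurable_fun `]0, T[ v)
  (vc : forall i s, (i < J)%N -> t i < s < t i.+1 -> v s = c i).

Lemma node_mono i j : (i <= j <= J)%N -> t i <= t j.
Proof.
move=> /andP[]; elim: j => [|j IH]; first by rewrite leqn0 => /eqP ->.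
rewrite leq_eqVlt => /predU1P[->//|ij jJ].
by apply: (le_trans (IH ij (ltnW jJ))); exact/ltW/tnd.
Qed.

Lemma node_ge0 i : (i <= J)%N -> 0 <= t i.
Proof. by move=> iJ; rewrite -t0; exact: node_mono. Qed.

Lemma node_leT i : (i <= J)%N -> t i <= T.
Proof. by move=> iJ; rewrite -tJ; apply: node_mono; rewrite iJ leqnn. Qed.

Lemma node_slab s : 0 < s < T -> (forall i, (i <= J)%N -> s != t i) ->
  exists2 i : 'I_J, t i < s < t i.+1 &
    forall j : 'I_J, j != i -> ~ (t j < s < t j.+1).
Proof.
move=> /andP[s0 sT] st.
have [i iJ tis] : exists2 i, (i < J)%N & t i < s < t i.+1.
  have : exists n, (n <= J)%N && (s < t n) by exists J; rewrite leqnn tJ.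
  move=> /ex_minnP[[|n] /andP[nJ sn] nmin].
    by move: sn; rewrite t0 ltNge (ltW s0).
  exists n => //; rewrite sn andbT lt_neqAle eq_sym st ?(ltnW nJ)//= leNgt.
  apply/negP => h; have := nmin n; rewrite (ltnW nJ) h => /(_ isT).
  by rewrite ltnn.
exists (Ordinal iJ) => // j ji /andP[h1 h2]; move: tis => /andP[h3 h4].
have : (j < i)%N || (i < j)%N.
  by rewrite -neq_ltn; apply: contra ji => /eqP/= e; apply/eqP/val_inj.
move=> /orP[lt|lt].
- have : t j.+1 <= t i by apply: node_mono; rewrite lt ltnW.
  by move=> /(lt_le_trans h2) /(lt_trans h3); rewrite ltxx.
- have : t i.+1 <= t j by apply: node_mono; rewrite lt ltnW//.
  by move=> /(lt_le_trans h4) /(lt_trans h1); rewrite ltxx.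
Qed.

(** Off the finite set of nodes, hence almost everywhere, v is the combination of
    the indicators of the open cells with coefficients c j. *)
Lemma step_integral (w : R -> R) (s : R) : s <= T ->
  mu.-integrable `]0, s[ (EFin \o w) ->
  \int[mu]_(r in `]0, s[) (w r * v r) =
  \sum_(j < J) c j * \int[mu]_(r in `]0, s[ `&` `]t j, t j.+1[) w r.
Proof.
move=> sT intw.
have mI (a b : R) : measurable (`]a, b[%classic : set (measurableTypeR R)).
  exact: measurable_itv.
pose f r := \sum_(j < J) c j * (w \_ `]t j, t j.+1[) r.
have intk (j : 'I_J) : mu.-integrable `]0, s[ (EFin \o (w \_ `]t j, t j.+1[)).
  rewrite -restrict_EFin; apply/(integrable_restrict _ (mI _ _) (mI _ _)).
  by apply: integrableS intw => //; exact: measurableI.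
have -> : \int[mu]_(r in `]0, s[) (w r * v r) = \int[mu]_(r in `]0, s[) f r.
  congr fine; apply: ae_eq_integral => //.
  - apply/measurable_EFinP; apply: measurable_funM.
      exact: (measurable_integrableR (mI _ _) intw).
    by apply: measurable_funS mv => //; apply: subset_itvl; rewrite bnd_simp.
  - apply/measurable_EFinP; apply: (@measurable_integrableR _ _ R mu) => //.
    by apply: integrableR_sum => // j; exact: integrableRZ.
  - exists (t @` `I_J.+1); split.
    + by apply: countable_measurable => //; apply: finite_set_countable; exact: finite_image.
    + apply: countable_lebesgue_measure0; apply: finite_set_countable; exact: finite_image.
    + move=> r /= /not_implyP[rs]; apply: contra_notP => rt; congr EFin.
      move: rs; rewrite /= in_itv/= => /andP[r0 rs].
      have [|i iJ|i ir ni] := @node_slab r; first by rewrite r0 (lt_le_trans rs).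
        by apply/eqP => e; apply: rt; exists i => //=; rewrite ltnS.
      rewrite (vc (ltn_ord i) ir) /f (bigD1 i)//= big1 ?addr0; last first.
        move=> j ji; rewrite patchE memNset ?mulr0//= in_itv/=; exact: ni.
      by rewrite patchE mem_set/= ?in_itv// mulrC.
rewrite Rintegral_sum//; last by move=> j; exact: integrableRZ.
apply: eq_bigr => j _.
by rewrite RintegralZl// -Rintegral_mkcondr.
Qed.

Lemma RL_step (b s : R) : 0 < b -> 0 < s <= T ->
  \int[mu]_(r in `]0, s[) ((s - r) `^ (b - 1) * v r) =
  b^-1 * \sum_(j < J) c j * (ppow b (s - t j) - ppow b (s - t j.+1)).
Proof.
move=> b0 /andP[s0 sT].
transitivity (\int[mu]_(r in `]0, s[) (ppow (b - 1) (s - r) * v r)).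
  apply: eq_Rintegral => r; rewrite inE/= in_itv/= => /andP[_ rs].
  by rewrite ppow_gt0E// subr_gt0.
rewrite step_integral//; last exact: integrable_ppowr.
rewrite mulr_sumr; apply: eq_bigr => j _.
rewrite RL_kernel_slab//; first by rewrite mulrCA.
by rewrite node_ge0 ?(ltnW (ltn_ord j))// ltW// tnd.
Qed.

Lemma step_mass k : (k <= J)%N ->
  \int[mu]_(r in `]0, t k[) v r = \sum_(j < k) (t j.+1 - t j) * c j.
Proof.
move=> kJ.
transitivity (\int[mu]_(r in `]0, t k[) (cst 1 r * v r)).
  by apply: eq_Rintegral => r _; rewrite mul1r.
rewrite step_integral ?node_leT//; last first.
  by apply: integrable_continuous_itv; exact: cst_continuous.
rewrite (big_ord_widen J (fun j => (t j.+1 - t j) * c j) kJ) [RHS]big_mkcond/=.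
apply: eq_bigr => j _; case: ifPn => jk.
  have jJ := ltn_ord j.
  have -> : `]0, t k[ `&` `]t j, t j.+1[ = `]t j, t j.+1[%classic.
    apply/seteqP; split => r /=; rewrite !in_itv/=; first by case.
    move=> /andP[r1 r2]; rewrite r1 r2 (le_lt_trans (node_ge0 (ltnW jJ)) r1)/=.
    by rewrite (lt_le_trans r2)// node_mono// jk.
  rewrite Rintegral_cst; last exact: measurable_itv.
  rewrite mul1r; set l := fine _.
  have -> : l = t j.+1 - t j.
    have := @lebesgue_measure_itv R `]t j, t j.+1[; rewrite /l /= lte_fin tnd// => ->.
    by rewrite -EFinB.
  exact: mulrC.
rewrite (_ : _ `&` _ = set0) ?Rintegral_set0 ?mulr0//.
rewrite -subset0 => r [/=]; rewrite !in_itv/= => /andP[_ r1] /andP[r2 _].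
move: jk; rewrite -leqNgt => kj.
have := lt_trans r2 r1; rewrite ltNge node_mono// kj/=.
exact: ltnW.
Qed.

End step_function.
End node.

(** * The cell averages as moments of the fractional derivative *)

Section node.
Context {R : realType}.
Local Notation mu := (@lebesgue_measure R).

(** Dominated convergence: on ]0, T[ all approximations are bounded by r_+^g. *)
Lemma cutoff_ppow_integral_cvg (g r T : R) (h : R -> R) : 0 < g -> r <= T ->
  mu.-integrable `]0, T[ (EFin \o h) ->
  \int[mu]_(s in `]0, T[) (h s * cutoff_ppow g r n s) @[n --> \oo] -->
  \int[mu]_(s in `]0, T[) (h s * ppow g (r - s)).
Proof.
move=> g0 rT inth.
have mI : measurable (`]0, T[%classic : set (measurableTypeR R)) by exact: measurable_itv.
have mh := measurable_integrableR mI inth.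
have mc n : measurable_fun `]0, T[ (cutoff_ppow g r n).
  apply: measurable_funTS; apply: continuous_measurable_fun.
  apply: (@time_test_continuous _ T).
  exact: time_test_cutoff_ppow.
have mp : measurable_fun `]0, T[ (fun s : R => ppow g (r - s)).
  apply: measurable_funTS.
  by apply: measurableT_comp; [exact: measurable_ppow|exact: measurable_funB].
have pr s : 0 <= s -> `|ppow g (r - s)| <= ppow g r.
  by move=> s0; rewrite ger0_norm ?ppow_ge0// le_ppow// lerBlDr lerDl.
have intp : mu.-integrable `]0, T[ (EFin \o (fun s => h s * ppow g (r - s))).
  apply: (@integrableRM_bounded _ _ R mu `]0, T[%classic h _ (ppow g r)) => //.
  by move=> s; rewrite /= in_itv/= => /andP[s0 _]; apply: pr; exact: ltW.
have [] := @dominated_convergence _ _ R mu `]0, T[%classic mI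
  (fun n s => (h s * cutoff_ppow g r n s)%:E) (fun s => (h s * ppow g (r - s))%:E)
  (fun s => (ppow g r * `|h s|)%:E).
- by move=> n; apply/measurable_EFinP; exact: (measurable_funM mh (mc n)).
- by apply/measurable_EFinP; exact: (measurable_funM mh mp).
- apply: aeW => s; rewrite /= in_itv/= => /andP[s0 sT]; apply: cvg_EFin; first exact: nearW.
  by apply: cvgMr; exact: cutoff_ppow_cvg.
- by apply: integrableRZ => //; exact: (integrable_norm inth).
- apply: aeW => s n; rewrite /= in_itv/= => /andP[s0 sT].
  by rewrite lee_fin normrM mulrC ler_wpM2r// cutoff_ppow_le// ltW.
move=> _ _ H; apply: fine_cvg; rewrite /Rintegral fineK; first exact: H.
exact: integrable_fin_num.
Qed.

Lemma integrableRBM (D : set (measurableTypeR R)) (f1 f2 w : R -> R) : measurable D ->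
  mu.-integrable D (EFin \o (fun s => f1 s * w s)) ->
  mu.-integrable D (EFin \o (fun s => f2 s * w s)) ->
  mu.-integrable D (EFin \o (fun s => (f1 s - f2 s) * w s)).
Proof.
move=> mD i1 i2; apply: eq_integrable (integrableRB mD i1 i2) => //.
by move=> s _ /=; rewrite mulrBl.
Qed.

Lemma RintegralBM (D : set (measurableTypeR R)) (f1 f2 w : R -> R) : measurable D ->
  mu.-integrable D (EFin \o (fun s => f1 s * w s)) ->
  mu.-integrable D (EFin \o (fun s => f2 s * w s)) ->
  \int[mu]_(s in D) ((f1 s - f2 s) * w s) =
  \int[mu]_(s in D) (f1 s * w s) - \int[mu]_(s in D) (f2 s * w s).
Proof.
by move=> mD i1 i2; rewrite -RintegralB//; apply: eq_Rintegral => s _; rewrite mulrBl.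
Qed.

(** The case a >= r, where the supports of the two factors are disjoint, is
    included through the maximum; it occurs for the cells after the node r. *)
Lemma beta_integral_support (g a r T : R) : 0 < g < 1 -> 0 <= a -> r <= T ->
  \int[mu]_(s in `]0, T[) (ppow (1 - g - 1) (s - a) * ppow g (r - s)) =
  Num.max 0 (r - a) * Rbeta g.
Proof.
move=> g01 a0 rT; rewrite (_ : 1 - g - 1 = - g); last by ring.
rewrite (@Rintegral_support _ _ R mu `]a, r[%classic); last 2 first.
- move=> s; rewrite /= !in_itv/= => /andP[as_ sr].
  by rewrite (le_lt_trans a0 as_) (lt_le_trans sr rT).
- move=> s _; rewrite /= in_itv/= => /negP; rewrite negb_and -!leNgt => /orP[sa|rs].
    by rewrite ppow_le0E ?mul0r// subr_le0.
  by rewrite (@ppow_le0E _ _ (r - s)) ?mulr0// subr_le0.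
have [ra|ar] := leP r a.
  rewrite set_itv_ge ?bnd_simp -?leNgt// Rintegral_set0 max_l ?mul0r//.
  by rewrite subr_le0.
by rewrite beta_integral ?(ltW ar)// max_r// subr_ge0 ltW.
Qed.

Section step_function.
Variables (g T : R) (J : nat) (t : nat -> R) (v G : R -> R) (c : nat -> R).
Hypotheses (g01 : 0 < g < 1) (t0 : t 0%N = 0) (tJ : t J = T)
  (tnd : forall i, (i < J)%N -> t i < t i.+1)
  (mv : measurable_fun `]0, T[ v)
  (vc : forall i s, (i < J)%N -> t i < s < t i.+1 -> v s = c i)
  (intG : mu.-integrable `]0, T[ (EFin \o G)).

(** Differentiating (s - t_j)_+^(1 - g) cancels the constant 1 - g produced by the
    fractional integration. *)
Lemma RL_step_test phi : time_test T phi ->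
  \int[mu]_(s in `]0, T[) (((Gamma (1 - g))^-1 *
      \int[mu]_(r in `]0, s[) ((s - r) `^ (1 - g - 1) * v r)) * derive1 phi s) =
  - \sum_(j < J) (Gamma (1 - g))^-1 * c j *
    \int[mu]_(s in `]0, T[)
      ((ppow (1 - g - 1) (s - t j) - ppow (1 - g - 1) (s - t j.+1)) * phi s).
Proof.
move=> tphi; have /andP[g0 g1] := g01; set b := 1 - g.
have b0 : 0 < b by rewrite subr_gt0.
have mI : measurable (`]0, T[%classic : set (measurableTypeR R)) by exact: measurable_itv.
have cphi := time_test_continuous tphi.
have cdphi := time_test_continuous_derive1 tphi.
have inti (a : R) : mu.-integrable `]0, T[ (EFin \o (fun s => ppow b (s - a) * derive1 phi s)).
  apply: integrable_continuous_itv => s; apply: cvgM; last exact: cdphi.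
  by apply: continuous_at_ppowl; exact: continuous_ppow.
pose F (j : 'I_J) s := ppow b (s - t j) - ppow b (s - t j.+1).
have intF j : mu.-integrable `]0, T[ (EFin \o (fun s => F j s * derive1 phi s)).
  exact: integrableRBM.
transitivity (\int[mu]_(s in `]0, T[)
   ((\sum_(j < J) ((Gamma b)^-1 * b^-1 * c j) * F j s) * derive1 phi s)).
  apply: eq_Rintegral => s; rewrite inE/= in_itv/= => /andP[s0 sT].
  rewrite (@RL_step R J T t v c) ?s0 ?(ltW sT)//.
  congr (_ * _); rewrite mulrA mulr_sumr; apply: eq_bigr => j _.
  by rewrite /F mulrA.
rewrite Rintegral_comb// -sumrN; apply: eq_bigr => j _.
have tj0 : 0 <= t j by apply: (@node_ge0 R J t) => //; exact: ltnW.
have tj1 : 0 <= t j.+1 by apply: (@node_ge0 R J t).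
rewrite /F RintegralBM// RintegralBM//; [|exact: integrable_ppowlM|exact: integrable_ppowlM].
rewrite !(@by_parts R b _ T)//.
have bn0 : b != 0 by rewrite gt_eqF.
have aux (x p q : R) : x * b^-1 * c j * (- (b * p) - - (b * q)) = - (x * c j * (p - q)).
  by field.
exact: aux.
Qed.

(** Testing with [cutoff_ppow] and passing to the limit pairs G, and the explicit
    derivative G0 of the fractional integral of v, with the same function
    (t_i - s)_+^g.  Against it, the two singular powers attached to a cell
    contribute Beta integrals whose difference is the length of the cell if it
    lies before t_i, and 0 otherwise. *)
Lemma node_identity i : (i <= J)%N ->
  (forall n,
    \int[mu]_(s in `]0, T[) (((Gamma (1 - g))^-1 *
      \int[mu]_(r in `]0, s[) ((s - r) `^ (1 - g - 1) * v r)) *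
      derive1 (cutoff_ppow g (t i) n) s) =
    - \int[mu]_(s in `]0, T[) (G s * cutoff_ppow g (t i) n s)) ->
  \sum_(j < i) c j * (t j.+1 - t j) =
  Gamma (1 - g) / Rbeta g * \int[mu]_(s in `]0, T[) (G s * ppow g (t i - s)).
Proof.
move=> iJ Hdist; have /andP[g0 g1] := g01; set b := 1 - g.
have b0 : 0 < b by rewrite subr_gt0.
have mI : measurable (`]0, T[%classic : set (measurableTypeR R)) by exact: measurable_itv.
have tiT : t i <= T by apply: (@node_leT R J).
have tj0 (j : 'I_J) : 0 <= t j by apply: (@node_ge0 R J t) => //; exact: ltnW.
have tj1 (j : 'I_J) : 0 <= t j.+1 by apply: (@node_ge0 R J t).
pose F (j : 'I_J) s := ppow (b - 1) (s - t j) - ppow (b - 1) (s - t j.+1).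
have intFw (w : R -> R) j : continuous w ->
    mu.-integrable `]0, T[ (EFin \o (fun s => F j s * w s)).
  move=> cw.
  by apply: integrableRBM => //; exact: integrable_ppowlM.
pose G0 s := \sum_(j < J) ((Gamma b)^-1 * c j) * F j s.
have intG0 : mu.-integrable `]0, T[ (EFin \o G0).
  apply: integrableR_sum => // j; apply: integrableRZ => //.
  have := intFw (cst 1) j (@cst_continuous _ _ _).
  by apply: eq_integrable => // s _ /=; rewrite mulr1.
have E : \int[mu]_(s in `]0, T[) (G0 s * ppow g (t i - s)) =
    \int[mu]_(s in `]0, T[) (G s * ppow g (t i - s)).
  have c0 := cutoff_ppow_integral_cvg g0 tiT intG0.
  suff c1 : \int[mu]_(s in `]0, T[) (G0 s * cutoff_ppow g (t i) n s) @[n --> \oo] -->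
      \int[mu]_(s in `]0, T[) (G s * ppow g (t i - s)).
    exact: (cvg_unique (@Rhausdorff R) c0 c1).
  apply: cvg_trans (cutoff_ppow_integral_cvg g0 tiT intG).
  apply: near_eq_cvg; apply: nearW => n.
  have tt := time_test_cutoff_ppow g n tiT.
  apply/oppr_inj; rewrite -Hdist RL_step_test//; congr (- _).
  rewrite Rintegral_comb// => j; apply: intFw.
  exact: time_test_continuous tt.
rewrite -E Rintegral_comb//; last first.
  by move=> j; apply: intFw => s; apply: continuous_at_ppowr; exact: continuous_ppow.
have B0 := Rbeta_gt0 g01.
have Ga0 : 0 < Gamma b by apply: Gamma_gt0; rewrite b0 /b lerBlDr lerDl ltW.
have Fj (j : 'I_J) : \int[mu]_(s in `]0, T[) (F j s * ppow g (t i - s)) =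
    (Num.max 0 (t i - t j) - Num.max 0 (t i - t j.+1)) * Rbeta g.
  have cw : continuous (fun s : R => ppow g (t i - s)).
    by move=> s; apply: continuous_at_ppowr; exact: continuous_ppow.
  rewrite /F RintegralBM//; [|exact: integrable_ppowlM|exact: integrable_ppowlM].
  by rewrite !beta_integral_support// mulrBl.
under [in RHS]eq_bigr do rewrite Fj.
rewrite (big_ord_widen J (fun j => c j * (t j.+1 - t j)) iJ) big_mkcond mulr_sumr/=.
apply: eq_bigr => j _; case: ifPn => ji.
  have h1 : t j <= t i by apply: (@node_mono R J) => //; rewrite iJ ltnW.
  have h2 : t j.+1 <= t i by apply: (@node_mono R J) => //; rewrite iJ ji.
  rewrite !max_r ?subr_ge0//; field; by rewrite !gt_eqF.
rewrite -leqNgt in ji.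
have h1 : t i <= t j by apply: (@node_mono R J) => //; rewrite ji ltnW.
have h2 : t i <= t j.+1 by apply: le_trans h1 _; exact/ltW/tnd.
by rewrite !max_l ?subr_le0// subrr mul0r !mulr0.
Qed.

End step_function.
End node.

(** * The discrete fractional inequality on a single time line *)

Section weighted_cs.
Context d (T : measurableType d) (R : realType).
Variable mu : {measure set T -> \bar R}.

(** The quadratic polynomial in l obtained by integrating (G - l)^2 k is
    nonnegative.  It is evaluated at its minimum, or, if k has integral 0, at a
    point that would make it negative unless the integral of G k vanishes. *)
Lemma weighted_cauchy_schwarz (D : set T) (G k : T -> R) : measurable D ->
  (forall x, D x -> 0 <= k x) ->
  mu.-integrable D (EFin \o k) ->
  mu.-integrable D (EFin \o (fun x => G x * k x)) ->
  mu.-integrable D (EFin \o (fun x => G x ^+ 2 * k x)) ->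
  (\int[mu]_(x in D) (G x * k x)) ^+ 2 <=
  \int[mu]_(x in D) k x * \int[mu]_(x in D) (G x ^+ 2 * k x).
Proof.
move=> mD k0 ik iGk iG2k.
set A := \int[mu]_(x in D) k x; set P := Rintegral _ _ _; set S := Rintegral _ _ _.
have quad (l : R) : 0 <= S - 2 * l * P + l ^+ 2 * A.
  have -> : S - 2 * l * P + l ^+ 2 * A =
      \int[mu]_(x in D) (G x ^+ 2 * k x - 2 * l * (G x * k x) + l ^+ 2 * k x).
    rewrite RintegralD//; [|apply: integrableRB => //|]; try exact: integrableRZ.
    by rewrite RintegralB//; [rewrite !RintegralZl|exact: integrableRZ].
  apply: Rintegral_ge0 => x Dx.
  rewrite (_ : _ + _ = (G x - l) ^+ 2 * k x); last by ring.
  by rewrite mulr_ge0 ?sqr_ge0 ?k0.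
have A0 : 0 <= A by exact: Rintegral_ge0.
have [A0'|A0'] := eqVneq A 0.
  rewrite A0' mul0r; have [->|P0] := eqVneq P 0; first by rewrite expr0n.
  have := quad ((S + 1) / (2 * P)); rewrite A0' mulr0 addr0.
  rewrite (_ : 2 * _ * P = S + 1); last by field.
  by lra.
have Apos : 0 < A by rewrite lt0r A0'.
have := quad (P / A); rewrite (_ : _ + _ = S - P ^+ 2 / A); last by field.
by rewrite subr_ge0 ler_pdivrMr// mulrC.
Qed.

End weighted_cs.

Section slab_kernel.
Context {R : realType}.
Local Notation mu := (@lebesgue_measure R).
Implicit Types (g delta u w s : R).

(** The kernel that produces the integral of v over the cell ]u, w[ from G. *)
Definition slab_kernel g u w s : R := ppow g (w - s) - ppow g (u - s).

Definition near_kernel g delta u w s : R :=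
  if u - delta < s then slab_kernel g u w s else 0.

Definition far_kernel g delta u w s : R :=
  if u - delta < s then 0 else slab_kernel g u w s.

Lemma near_far_kernel g delta u w s :
  slab_kernel g u w s = near_kernel g delta u w s + far_kernel g delta u w s.
Proof. by rewrite /near_kernel /far_kernel; case: ifPn; rewrite ?addr0 ?add0r. Qed.

Lemma slab_kernel_ge0 g u w s : 0 < g -> u <= w -> 0 <= slab_kernel g u w s.
Proof. by move=> g0 uw; rewrite subr_ge0 le_ppow// lerD2r. Qed.

Lemma near_kernel_ge0 g delta u w s : 0 < g -> u <= w ->
  0 <= near_kernel g delta u w s.
Proof. by move=> *; rewrite /near_kernel; case: ifP => // _; exact: slab_kernel_ge0. Qed.

Lemma far_kernel_ge0 g delta u w s : 0 < g -> u <= w ->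
  0 <= far_kernel g delta u w s.
Proof. by move=> *; rewrite /far_kernel; case: ifP => // _; exact: slab_kernel_ge0. Qed.

Lemma slab_kernel_le g u w s : 0 < g -> 0 <= s -> slab_kernel g u w s <= ppow g w.
Proof.
move=> g0 s0; rewrite lerBlDr (@le_trans _ _ (ppow g w))//.
  by rewrite le_ppow// lerBlDr lerDl.
by rewrite lerDl ppow_ge0.
Qed.

Lemma measurable_slab_kernel g u w : measurable_fun setT (slab_kernel g u w).
Proof.
by apply: measurable_funB; (apply: measurableT_comp; first exact: measurable_ppow);
  exact: measurable_funB.
Qed.

Lemma measurable_near_kernel g delta u w :
  measurable_fun setT (near_kernel g delta u w).
Proof.
apply: measurable_fun_ifT => //; last exact: measurable_slab_kernel.
exact: (@measurable_fun_ltr _ _ _ setT (cst (u - delta)) id).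
Qed.

Lemma measurable_far_kernel g delta u w :
  measurable_fun setT (far_kernel g delta u w).
Proof.
apply: measurable_fun_ifT => //; last exact: measurable_slab_kernel.
exact: (@measurable_fun_ltr _ _ _ setT (cst (u - delta)) id).
Qed.

Lemma near_kernel_le g delta u w s : 0 < g -> 0 <= s -> u <= w ->
  `|near_kernel g delta u w s| <= ppow g w.
Proof.
move=> g0 s0 uw; rewrite ger0_norm ?near_kernel_ge0// /near_kernel.
by case: ifPn => _; [exact: slab_kernel_le|exact: ppow_ge0].
Qed.

Lemma far_kernel_le g delta u w s : 0 < g -> 0 <= s -> u <= w ->
  `|far_kernel g delta u w s| <= ppow g w.
Proof.
move=> g0 s0 uw; rewrite ger0_norm ?far_kernel_ge0// /far_kernel.
by case: ifPn => _; [exact: ppow_ge0|exact: slab_kernel_le].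
Qed.

(** At distance at least delta before the cell the kernel is smooth, and the mean
    value theorem bounds it linearly in the length of the cell. *)
Lemma far_kernel_lipschitz g delta u w s : 0 < g < 1 -> 0 < delta -> u < w ->
  far_kernel g delta u w s <= g * delta `^ (g - 1) * (w - u).
Proof.
move=> /andP[g0 g1] d0 uw.
rewrite /far_kernel; case: ifPn => [_|]; first by rewrite !mulr_ge0 ?powR_ge0 ?subr_ge0// ltW.
rewrite -leNgt /slab_kernel => sud; have us : delta <= u - s by lra.
have [|x /andP[x1 x2] ->] := @ppow_MVT R g (u - s) (w - s) g0 (le_trans (ltW d0) us).
  by rewrite ltrD2r.
rewrite (_ : w - s - (u - s) = w - u); last by ring.
rewrite ler_wpM2r ?subr_ge0 ?(ltW uw)// ler_wpM2l ?(ltW g0)//.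
have x0 : 0 < x by rewrite (lt_trans _ x1)// (lt_le_trans d0).
rewrite ppow_gt0E// -opprB !powRN lef_pV2 ?posrE ?powR_gt0//.
rewrite ge0_ler_powR ?nnegrE ?subr_ge0 ?(ltW g1) ?(ltW d0) ?(ltW x0)//.
by rewrite (le_trans us)// ltW.
Qed.

Lemma far_kernel_eq0 g delta u w s : 0 < delta -> u <= s ->
  far_kernel g delta u w s = 0.
Proof. by move=> d0 us; rewrite /far_kernel ifT//; lra. Qed.

(** Both powers are integrated explicitly from l = max(0, u - delta) on; the mean
    value theorem for the power g + 1 compares the results. *)
Lemma near_kernel_mass g delta u w T : 0 < g -> 0 < delta ->
  0 <= u -> u < w -> w <= T ->
  \int[mu]_(s in `]0, T[) near_kernel g delta u w s <=
  ppow g (delta + (w - u)) * (w - u).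
Proof.
move=> g0 d0 u0 uw wT; pose l := Num.max 0 (u - delta).
have lu : l <= u by rewrite ge_max u0/=; lra.
have l0 : 0 <= l by rewrite le_max lexx.
have lud : u - delta <= l by rewrite le_max lexx orbT.
have lw : l < w := le_lt_trans lu uw.
rewrite (@Rintegral_support _ _ R mu `]l, w[%classic); last 2 first.
- move=> s; rewrite /= !in_itv/= => /andP[ls sw].
  by rewrite (le_lt_trans l0 ls) (lt_le_trans sw wT).
- move=> s; rewrite /= !in_itv/= => /andP[s0 sT] /negP.
  rewrite negb_and -!leNgt /near_kernel le_max leNgt s0/= => /orP[h|ws].
    by rewrite ltNge h.
  case: ifP => // _; rewrite /slab_kernel !ppow_le0E ?subrr// subr_le0//.
  by rewrite (le_trans (ltW uw)).
have -> : \int[mu]_(s in `]l, w[) near_kernel g delta u w s =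
    \int[mu]_(s in `]l, w[) (ppow (g + 1 - 1) (w - s) - ppow (g + 1 - 1) (u - s)).
  apply: eq_Rintegral => s; rewrite inE/= in_itv/= => /andP[ls _].
  by rewrite /near_kernel ifT ?addrK//; exact: le_lt_trans ls.
have gp : 0 < g + 1 by rewrite ltr_wpDl// ltW.
have int2 : mu.-integrable `]l, w[ (EFin \o (fun s => ppow (g + 1 - 1) (u - s))).
  apply: (@integrable_support _ _ R mu `]l, u[%classic);
    [exact: measurable_itv|exact: measurable_itv| | |exact: integrable_ppowr].
    by apply: subset_itvl; rewrite bnd_simp ltW.
  move=> s; rewrite /= !in_itv/= => /andP[-> _]/= /negP; rewrite -leNgt => us.
  by rewrite ppow_le0E// subr_le0.
rewrite RintegralB; [|exact: measurable_itv|exact: integrable_ppowr|exact: int2].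
rewrite Rintegral_ppowr ?(ltW lw)// subrr (ppow_le0E _ (lexx 0)) subr0.
rewrite (@Rintegral_support _ _ R mu `]l, u[%classic); last 2 first.
- by apply: subset_itvl; rewrite bnd_simp ltW.
- move=> s; rewrite /= !in_itv/= => /andP[-> _]/= /negP; rewrite -leNgt => us.
  by rewrite ppow_le0E// subr_le0.
rewrite Rintegral_ppowr// subrr (ppow_le0E _ (lexx 0)) subr0 -mulrBr.
have [||x /andP[x1 x2] ->] := @ppow_MVT R (g + 1) (u - l) (w - l) gp.
  by rewrite subr_ge0.
  by rewrite ltrD2r.
rewrite (_ : w - l - (u - l) = w - u); last by ring.
rewrite mulrA mulKf ?gt_eqF// addrK ler_wpM2r ?subr_ge0 ?(ltW uw)//.
by rewrite le_ppow//; lra.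
Qed.

(** The sum telescopes as long as the cells lie within delta after s.  The last of
    them ends at most delta + tau after s, and later cells contribute nothing. *)
Lemma sum_near_kernel g delta tau (t : nat -> R) k s : 0 < g -> 0 < delta ->
  (forall j, (j < k)%N -> t j <= t j.+1) ->
  (forall j, (j < k)%N -> t j.+1 - t j <= tau) ->
  \sum_(j < k) near_kernel g delta (t j) (t j.+1) s <=
  Num.min (ppow g (t k - s)) (ppow g (delta + tau)).
Proof.
move=> g0 d0; elim: k => [|k IH] tnd ttau.
  by rewrite big_ord0 le_min !ppow_ge0.
rewrite big_ord_recr/= /near_kernel.
have {}IH := IH (fun j jk => tnd j (ltnW jk)) (fun j jk => ttau j (ltnW jk)).
have := tnd k (ltnSn k); have := ttau k (ltnSn k) => hk1 hk2.
move: IH; rewrite !le_min => /andP[IH1 IH2].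
case: ifPn => h.
  have e : \sum_(j < k) near_kernel g delta (t j) (t j.+1) s +
      slab_kernel g (t k) (t k.+1) s <= ppow g (t k.+1 - s).
    by rewrite /slab_kernel addrCA gerDl subr_le0.
  rewrite e/= (le_trans e)// le_ppow//; lra.
rewrite addr0 IH2 andbT (le_trans IH1)// le_ppow//; lra.
Qed.

End slab_kernel.

Section discrete_bound.
Context {R : realType}.
Local Notation mu := (@lebesgue_measure R).
Variables (g T delta tau kappa : R) (J : nat) (t c : nat -> R) (G : R -> R).
Hypotheses (g01 : 0 < g < 1) (d0 : 0 < delta) (T0 : 0 < T)
  (tge0 : forall i, (i <= J)%N -> 0 <= t i <= T)
  (tnd : forall i, (i < J)%N -> t i < t i.+1)
  (ttau : forall i, (i < J)%N -> t i.+1 - t i <= tau)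
  (intG : mu.-integrable `]0, T[ (EFin \o G))
  (intG2 : mu.-integrable `]0, T[ (EFin \o (fun s => G s ^+ 2)))
  (node : forall i, (i <= J)%N -> \sum_(j < i) c j * (t j.+1 - t j) =
     kappa * \int[mu]_(s in `]0, T[) (G s * ppow g (t i - s))).

Let Q i := \int[mu]_(s in `]0, t i[) (G s ^+ 2).
Let mI : measurable (`]0, T[%classic : set (measurableTypeR R)) := measurable_itv _.
Let g0 : 0 < g. Proof. by have /andP[] := g01. Qed.

Let intM (F k : R -> R) M : mu.-integrable `]0, T[ (EFin \o F) ->
  measurable_fun setT k -> (forall s, 0 <= s -> `|k s| <= M) ->
  mu.-integrable `]0, T[ (EFin \o (fun s => F s * k s)).
Proof.
move=> iF mk kM; apply: (@integrableRM_bounded _ _ R mu `]0, T[%classic F k M) => //.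
  exact: measurable_funTS.
by move=> s; rewrite /= in_itv/= => /andP[s0 _]; apply: kM; exact: ltW.
Qed.

Let int1 (k : R -> R) M : measurable_fun setT k ->
  (forall s, 0 <= s -> `|k s| <= M) -> mu.-integrable `]0, T[ (EFin \o k).
Proof.
move=> mk kM.
have := @intM (cst 1) k M (integrable_continuous_itv 0 T (@cst_continuous _ _ _)) mk kM.
by apply: eq_integrable => // s _ /=; rewrite mul1r.
Qed.

(** For the near part the mass of the kernel is small; for the far part both
    factors of the Cauchy-Schwarz bound are linear in the length of the cell.
    Either way one factor t_(j+1) - t_j can be divided out. *)
Lemma slab_square j : (j < J)%N ->
  (t j.+1 - t j) * c j ^+ 2 <= 2 * kappa ^+ 2 *
   (ppow g (delta + tau) *
      \int[mu]_(s in `]0, T[) (G s ^+ 2 * near_kernel g delta (t j) (t j.+1) s) +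
    (g * delta `^ (g - 1)) ^+ 2 * T * ((t j.+1 - t j) * Q j)).
Proof.
move=> jJ; set u := t j; set w := t j.+1.
have uw : u < w by exact: tnd.
have [/andP[u0 uT] /andP[w0 wT]] := (tge0 (ltnW jJ), tge0 jJ).
set N := near_kernel g delta u w; set F := far_kernel g delta u w.
have wu0 : 0 < w - u by rewrite subr_gt0.
have mN : measurable_fun setT N by exact: measurable_near_kernel.
have mF : measurable_fun setT F by exact: measurable_far_kernel.
have bN s : 0 <= s -> `|N s| <= ppow g w by move=> s0; apply: near_kernel_le => //; exact: ltW.
have bF s : 0 <= s -> `|F s| <= ppow g w by move=> s0; apply: far_kernel_le => //; exact: ltW.
have iGN := intM intG mN bN; have iGF := intM intG mF bF.
have iG2N := intM intG2 mN bN; have iG2F := intM intG2 mF bF.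
have ip i : (i <= J)%N -> mu.-integrable `]0, T[ (EFin \o (fun s => G s * ppow g (t i - s))).
  move=> iJ; apply: (intM intG (M := ppow g (t i))).
    by apply: measurableT_comp; [exact: measurable_ppow|exact: measurable_funB].
  by move=> s s0; rewrite ger0_norm ?ppow_ge0// le_ppow// lerBlDr lerDl.
have cE : c j * (w - u) = kappa * (\int[mu]_(s in `]0, T[) (G s * N s) +
    \int[mu]_(s in `]0, T[) (G s * F s)).
  have := node jJ; rewrite big_ord_recr/= (node (ltnW jJ)) => h.
  have -> : c j * (w - u) = kappa * (\int[mu]_(s in `]0, T[) (G s * ppow g (w - s)) -
      \int[mu]_(s in `]0, T[) (G s * ppow g (u - s))).
    rewrite [in RHS]mulrBr; apply/eqP; rewrite eq_sym subr_eq addrC.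
    by apply/eqP/esym; exact: h.
  rewrite -RintegralB//; [|exact: ip|by apply: ip; exact: ltnW].
  rewrite -RintegralD//; congr (_ * _); apply: eq_Rintegral => s _.
  by rewrite -mulrBr -mulrDr -near_far_kernel.
have csN := @weighted_cauchy_schwarz _ _ R mu _ G N mI
  (fun s _ => near_kernel_ge0 delta s g0 (ltW uw)) (int1 mN bN) iGN iG2N.
have csF := @weighted_cauchy_schwarz _ _ R mu _ G F mI
  (fun s _ => far_kernel_ge0 delta s g0 (ltW uw)) (int1 mF bF) iGF iG2F.
set m := g * delta `^ (g - 1).
have m0 : 0 <= m by rewrite mulr_ge0 ?powR_ge0// ltW.
have massN : \int[mu]_(s in `]0, T[) N s <= ppow g (delta + tau) * (w - u).
  apply: (le_trans (near_kernel_mass g0 d0 u0 uw wT)).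
  by rewrite ler_wpM2r ?(ltW wu0)// le_ppow// lerD2l; exact: ttau.
have massF : \int[mu]_(s in `]0, T[) F s <= m * (w - u) * T.
  apply: (@le_trans _ _ (\int[mu]_(s in `]0, T[) (m * (w - u)))).
    apply: le_Rintegral => //; first exact: (int1 mF bF).
      by apply: integrable_continuous_itv; exact: cst_continuous.
    by move=> s _; exact: far_kernel_lipschitz.
  rewrite Rintegral_cst//; set l := fine _.
  have -> : l = T.
    rewrite /l; have := @lebesgue_measure_itv R `]0, T[.
    by rewrite /= lte_fin T0 oppr0 adde0 => ->.
  exact: lexx.
have QF : \int[mu]_(s in `]0, T[) (G s ^+ 2 * F s) <= m * (w - u) * Q j.
  have sub : (`]0, u[%classic : set R) `<=` `]0, T[%classic.
    by apply: subset_itvl; rewrite bnd_simp.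
  have mu_ : measurable (`]0, u[%classic : set (measurableTypeR R)) by exact: measurable_itv.
  have iQ : mu.-integrable `]0, u[ (EFin \o (fun s => G s ^+ 2)) by apply: integrableS intG2.
  rewrite (@Rintegral_support _ _ R mu `]0, u[%classic)//; last first.
    move=> s; rewrite /= !in_itv/= => /andP[-> _]/= /negP; rewrite -leNgt => us.
    by rewrite /F far_kernel_eq0// mulr0.
  rewrite /Q -RintegralZl//; apply: le_Rintegral => //.
  - by apply: integrableS iG2F.
  - exact: integrableRZ.
  - by move=> s _; rewrite mulrC ler_wpM2r ?sqr_ge0//; exact: far_kernel_lipschitz.
have Q0 : 0 <= Q j by apply: Rintegral_ge0 => s _; exact: sqr_ge0.
set SN := \int[mu]_(s in _) (_ ^+ 2 * N s) in csN *.
have SN0 : 0 <= SN.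
  apply: Rintegral_ge0 => s _; rewrite mulr_ge0 ?sqr_ge0//.
  exact: (near_kernel_ge0 delta s g0 (ltW uw)).
have SF0 : 0 <= \int[mu]_(s in `]0, T[) (G s ^+ 2 * F s).
  apply: Rintegral_ge0 => s _; rewrite mulr_ge0 ?sqr_ge0//.
  exact: (far_kernel_ge0 delta s g0 (ltW uw)).
have hN := le_trans csN (ler_wpM2r SN0 massN).
have hF := le_trans csF (le_trans (ler_wpM2r SF0 massF)
  (ler_wpM2l (mulr_ge0 (mulr_ge0 m0 (ltW wu0)) (ltW T0)) QF)).
rewrite -(ler_pM2l wu0).
have -> : (w - u) * ((w - u) * c j ^+ 2) = (c j * (w - u)) ^+ 2 by ring.
rewrite cE; set X := Rintegral _ _ _ in hN *; set Y := Rintegral _ _ _ in hF *.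
have XY : (X + Y) ^+ 2 <= 2 * (X ^+ 2 + Y ^+ 2).
  by have := sqr_ge0 (X - Y); lra.
rewrite exprMn.
have two0 : 0 <= 2 :> R by [].
apply: (le_trans (ler_wpM2l (sqr_ge0 kappa) (le_trans XY (ler_wpM2l two0 (lerD hN hF))))).
by rewrite le_eqVlt; apply/orP; left; apply/eqP; ring.
Qed.

(** The near kernels of all cells are summed under the integral, where their sum is
    again small, so that no factor counting the cells appears. *)
Lemma discrete_bound k : (k <= J)%N ->
  \sum_(j < k) (t j.+1 - t j) * c j ^+ 2 <= 2 * kappa ^+ 2 *
   (ppow g (delta + tau) ^+ 2 * Q k +
    (g * delta `^ (g - 1)) ^+ 2 * T * \sum_(j < k) (t j.+1 - t j) * Q j).
Proof.
move=> kJ.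
have jJ (j : 'I_k) : (j < J)%N by exact: leq_trans (ltn_ord j) kJ.
apply: (le_trans (ler_sum _ (fun j _ => slab_square (jJ j)))).
rewrite -mulr_sumr; apply: ler_wpM2l; first by apply: mulr_ge0 => //; exact: sqr_ge0.
rewrite big_split/= -!mulr_sumr lerD2r expr2 -mulrA ler_wpM2l ?ppow_ge0//.
have iN (j : 'I_k) : mu.-integrable `]0, T[
    (EFin \o (fun s => G s ^+ 2 * near_kernel g delta (t j) (t j.+1) s)).
  apply: (intM intG2 (measurable_near_kernel _ _ _ _)) => s s0.
  by apply: near_kernel_le => //; exact/ltW/tnd.
rewrite -Rintegral_sum//.
have /andP[k0 kT] := tge0 kJ.
have sub : (`]0, t k[%classic : set R) `<=` `]0, T[%classic.
  by apply: subset_itvl; rewrite bnd_simp.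
have mk : measurable (`]0, t k[%classic : set (measurableTypeR R)) by exact: measurable_itv.
have ksum s : \sum_(j < k) near_kernel g delta (t j) (t j.+1) s <=
    Num.min (ppow g (t k - s)) (ppow g (delta + tau)).
  apply: sum_near_kernel => // j jk; first exact/ltW/tnd/(leq_trans jk).
  exact/ttau/(leq_trans jk).
have ksum0 s : 0 <= \sum_(j < k) near_kernel g delta (t j) (t j.+1) s.
  by apply: sumr_ge0 => j _; apply: near_kernel_ge0 => //; exact/ltW/tnd.
rewrite (@Rintegral_support _ _ R mu `]0, t k[%classic)//; last first.
  move=> s; rewrite /= !in_itv/= => /andP[-> _]/= /negP; rewrite -leNgt => us.
  rewrite -mulr_sumr; have := ksum s; rewrite (@ppow_le0E _ _ (t k - s)) ?subr_le0//.
  rewrite le_min => /andP[h _].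
  have -> : \sum_(j < k) near_kernel g delta (t j) (t j.+1) s = 0.
    by apply/eqP; rewrite eq_le h ksum0.
  by rewrite mulr0.
rewrite /Q -RintegralZl//; last by apply: integrableS intG2.
apply: le_Rintegral => //.
- by apply: integrableR_sum => // j; apply: integrableS (iN j).
- by apply: integrableRZ => //; apply: integrableS intG2.
- move=> s _; rewrite -mulr_sumr mulrC ler_wpM2r ?sqr_ge0//.
  by have := ksum s; rewrite le_min => /andP[].
Qed.

End discrete_bound.

(** * The graded grid and the discrete Gronwall inequality *)

Section grid.
Context {R : realType}.
Variables (T sigma : R) (J : nat).
Hypotheses (T0 : 0 < T) (s1 : 1 <= sigma) (J0 : (0 < J)%N).

Let t := tgrid T sigma J.
Let s0 : 0 < sigma := lt_le_trans ltr01 s1.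
Let Jr0 : 0 < J%:R :> R. Proof. by rewrite ltr0n. Qed.

Lemma tgridE j : t j = ppow sigma (j%:R / J%:R) * T.
Proof.
rewrite /t /tgrid; congr (_ * _); case: j => [|j].
  by rewrite mul0r powR0 ?gt_eqF// ppow_le0E.
by rewrite ppow_gt0E// divr_gt0// ltr0n.
Qed.

Lemma tgrid0 : t 0%N = 0.
Proof. by rewrite tgridE mul0r ppow_le0E// mul0r. Qed.

Lemma tgridJ : t J = T.
Proof. by rewrite /t /tgrid divff ?gt_eqF// powR1 mul1r. Qed.

(** All information on the step sizes is drawn from this mean value formula: the
    intermediate points increase with j and stay below 1. *)
Lemma tgrid_step j : exists2 x : R, j%:R / J%:R < x < j.+1%:R / J%:R &
  t j.+1 - t j = sigma * ppow (sigma - 1) x * (T / J%:R).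
Proof.
have [||x xj E] := @ppow_MVT R sigma (j%:R / J%:R) (j.+1%:R / J%:R) s0.
- by rewrite divr_ge0.
- by rewrite ltr_pM2r ?invr_gt0// ltr_nat.
exists x => //; rewrite !tgridE -mulrBl E -natr1.
by field; rewrite gt_eqF.
Qed.

Lemma tgrid_lt j : t j < t j.+1.
Proof.
have [x /andP[x0 _] E] := tgrid_step j.
rewrite -subr_gt0 E mulr_gt0 ?divr_gt0// mulr_gt0// ppow_gt0E ?powR_gt0//;
  by apply: le_lt_trans x0; rewrite divr_ge0.
Qed.

Lemma tgrid_step_le i j : (i <= j)%N -> t i.+1 - t i <= t j.+1 - t j.
Proof.
rewrite leq_eqVlt => /predU1P[->//|ij].
have [x /andP[x1 x2] ->] := tgrid_step i.
have [y /andP[y1 y2] ->] := tgrid_step j.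
have x0 : 0 < x by apply: le_lt_trans x1; rewrite divr_ge0.
have xy : x <= y.
  apply/ltW/(lt_trans x2)/(le_lt_trans _ y1).
  by rewrite ler_pM2r ?invr_gt0// ler_nat.
rewrite ler_wpM2r ?divr_ge0 ?(ltW T0)// ler_wpM2l ?(ltW s0)//.
have y0 := lt_le_trans x0 xy.
by rewrite !ppow_gt0E// ge0_ler_powR ?subr_ge0 ?nnegrE// ltW.
Qed.

Lemma tgrid_last_step_le : t J - t J.-1 <= sigma * T / J%:R.
Proof.
have [y] := tgrid_step J.-1; rewrite prednK// divff ?gt_eqF// => /andP[y1 y2] ->.
have y0 : 0 < y by apply: le_lt_trans y1; rewrite divr_ge0.
rewrite -[leRHS]mulrA ler_wpM2r ?divr_ge0 ?(ltW T0)//.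
rewrite -[leRHS]mulr1 ler_wpM2l ?(ltW s0)//.
rewrite ppow_gt0E//; have := @ge0_ler_powR R (sigma - 1) _ y 1.
by rewrite subr_ge0 s1 powR1 !nnegrE; apply => //; exact: ltW.
Qed.

End grid.

Lemma discrete_gronwall (R : realType) (J : nat) (e L tau : R) (b w : nat -> R) :
  0 <= e -> 0 <= L ->
  (forall j, (j < J)%N -> 0 <= w j <= tau) ->
  (forall k, (k <= J)%N -> b k <= e + L * \sum_(j < k) w j * b j) ->
  forall k, (k <= J)%N -> b k <= e * expR (L * (k%:R * tau)).
Proof.
move=> e0 L0 wtau H k kJ; apply: (le_trans (H k kJ)).
elim: k kJ => [|k IH] kJ.
  by rewrite big_ord0 mulr0 addr0 mul0r mulr0 expR0 mulr1.
have /andP[w0 wt] := wtau k kJ; have {}IH := IH (ltnW kJ).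
have Sk0 : 0 <= e * expR (L * (k%:R * tau)) by rewrite mulr_ge0 ?expR_ge0.
have wb : w k * b k <= tau * (e * expR (L * (k%:R * tau))).
  apply: (@le_trans _ _ (w k * (e * expR (L * (k%:R * tau))))).
    by rewrite ler_wpM2l// (le_trans (H k (ltnW kJ))).
  by rewrite ler_wpM2r.
rewrite big_ord_recr/= mulrDr addrA.
apply: (le_trans (lerD IH (ler_wpM2l L0 wb))).
have -> : e * expR (L * (k%:R * tau)) + L * (tau * (e * expR (L * (k%:R * tau)))) =
  e * expR (L * (k%:R * tau)) * (1 + L * tau) by ring.
have -> : L * (k.+1%:R * tau) = L * (k%:R * tau) + L * tau by rewrite -natr1; ring.
by rewrite expRD [leRHS]mulrA ler_wpM2l// expR_ge1Dx.
Qed.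

(** * From time lines to the space-time norm *)

Section open_rV.
Context {R : realType} {d : nat}.

(** An open set is the union of the open cubes contained in it with rational centre
    and radius 1/(n+1); these cubes are countably many. *)
Lemma open_measurable_rV (U : set 'rV[R]_d) : open U -> measurable U.
Proof.
move=> oU.
pose F (qn : 'rV[rat]_d * nat) : set 'rV[R]_d :=
  \bigcap_(i in [set: 'I_d])
    (rV_coord i @^-1` (ball (ratr (qn.1 ord0 i) : R) (harmonic qn.2))).
have mF qn : measurable (F qn).
  apply: fin_bigcap_measurable => [|i _]; first exact: finite_finset.
  rewrite -[X in measurable X]setTI; apply: measurable_rV_coord => //.
  exact: measurable_ball.
have -> : U = \bigcup_(qn in [set qn | F qn `<=` U]) F qn.
  apply/seteqP; split => [x Ux|x [qn /= FU]]; last exact: FU.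
  have /nbhs_ballP[e /= e0 xeU] : nbhs x U by exact: open_nbhs_nbhs.
  have [n ne] : exists n, harmonic n < e / 2 :> R.
    have /cvgr_lt : @harmonic R @ \oo --> 0 by exact: cvg_harmonic.
    by move=> /(_ (e / 2)); rewrite divr_gt0// => /(_ isT)[n _ /(_ n (leqnn n))] ?; exists n.
  have h0 : 0 < harmonic n :> R by rewrite invr_gt0.
  have qi (i : 'I_d) : exists q : rat, `|ratr q - x ord0 i| < harmonic n.
    have [|q] := @rat_in_itvoo R (x ord0 i - harmonic n) (x ord0 i + harmonic n).
      by lra.
    rewrite in_itv/= => /andP[q1 q2]; exists q.
    by rewrite ltr_distl q1.
  have [q qP] := choice qi.
  exists (\row_i q i, n) => /=.
    move=> y Fy; apply: xeU; split=> // i j; rewrite (ord1 i).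
    have := Fy j I; rewrite /rV_coord/= mxE /ball/= => yq.
    have := qP j => xq.
    rewrite (_ : _ - _ = - (ratr (q j) - x ord0 j) + (ratr (q j) - y ord0 j)); last by ring.
    by rewrite (le_lt_trans (ler_normD _ _))// normrN (splitr e) ltrD// (lt_trans _ ne).
  by move=> i _; rewrite /rV_coord/= mxE /ball/=; exact: qP.
rewrite bigcup_mkcond; apply: countable_bigcupT_measurable => [|qn].
  exact: countableP.
by case: ifP => // _; exact: measurable0.
Qed.
End open_rV.

Section time_energy.
Context {R : realType} {d : nat}.
Local Notation mu := (@lebesgue_measure R).
Local Notation Rm := (measurableTypeR R).
Variables (Omega : set 'rV[R]_d) (T : R) (U : R -> 'rV[R]_d -> R).
Hypotheses (mO : measurable Omega)
  (mU : measurable_fun (`]0, T[ `*` Omega : set (Rm * 'rV[R]_d)) (fun p => U p.1 p.2)).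

(** The squared time norm on the line through x; swapping the order of integration
    makes it the density, in x, of the space-time norm. *)
Definition time_energy (t : R) (x : 'rV[R]_d) : \bar R :=
  (\int[mu]_(s in `]0%R, t[) (U s x ^+ 2)%:E)%E.

Lemma time_energy_ge0 t x : (0 <= time_energy t x)%E.
Proof. by apply: integral_ge0 => s _; rewrite lee_fin sqr_ge0. Qed.

Let D t : set (Rm * 'rV[R]_d) := `]0, t[ `*` Omega.
Let mD t : measurable (D t). Proof. by apply: measurableX => //; exact: measurable_itv. Qed.
Let f t : Rm * 'rV[R]_d -> \bar R := (fun p => (U p.1 p.2 ^+ 2)%:E) \_ (D t).

Let subD t : t <= T -> D t `<=` D T.
Proof.
move=> tT [s x] [/= h1 h2]; split => //.
by apply: subset_itvl h1; rewrite bnd_simp.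
Qed.

Let mf t : t <= T -> measurable_fun setT (f t).
Proof.
move=> tT; apply/(measurable_restrictT _ (mD t))/measurable_EFinP.
apply: measurable_funX; apply: measurable_funS mU; first exact: mD.
exact: subD.
Qed.

Let f0 t p : (0 <= f t p)%E.
Proof. by rewrite /f patchE; case: ifPn => // _; rewrite lee_fin sqr_ge0. Qed.

Let fE t s x : f t (s, x) =
  if (s \in `]0, t[%classic) && (x \in Omega) then (U s x ^+ 2)%:E else 0%E.
Proof. by rewrite /f patchE /D in_setX. Qed.

Let fG t x : Omega x -> fubini_G mu (f t) x = time_energy t x.
Proof.
move=> Ox; rewrite /time_energy integral_mkcond; apply: eq_integral => s _.
by rewrite fE patchE (mem_set Ox) andbT.
Qed.

Lemma measurable_time_energy t : t <= T -> measurable_fun Omega (time_energy t).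
Proof.
move=> tT.
have : measurable_fun Omega (fubini_G mu (f t)).
  by apply: measurable_funTS; exact: (measurable_fun_fubini_tonelli_G _ (mf tT) (f0 t)).
by apply: eq_measurable_fun => x; rewrite inE => Ox; rewrite fG.
Qed.

Lemma norm_L2L2_time_energy t : t <= T ->
  (\int[mu]_(s in `]0%R, t[) sqnorm_L2 Omega (U s) =
   \int[lebesgueRd R d]_(x in Omega) time_energy t x)%E.
Proof.
move=> tT.
have := @fubini_tonelli _ _ Rm 'rV[R]_d R mu (lebesgueRd R d) (f t) (mf tT) (f0 t).
have -> : (\int[mu]_s \int[lebesgueRd R d]_x f t (s, x) =
   \int[mu]_(s in `]0%R, t[) sqnorm_L2 Omega (U s))%E.
  rewrite [RHS]integral_mkcond; apply: eq_integral => s _.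
  rewrite patchE; case: ifPn => hs.
    rewrite /sqnorm_L2 [RHS]integral_mkcond; apply: eq_integral => x _.
    by rewrite fE hs/= patchE.
  by apply: integral0_eq => x _; rewrite fE (negbTE hs).
move=> ->; rewrite [RHS]integral_mkcond; apply: eq_integral => x _.
rewrite patchE; case: ifPn => hx; first by rewrite -fG//; exact: set_mem.
by apply: integral0_eq => s _; rewrite fE (negbTE hx) andbF.
Qed.

Lemma measurable_time_section x : Omega x -> measurable_fun `]0, T[ (U ^~ x).
Proof.
move=> Ox.
have mh : measurable_fun setT ((fun p : Rm * 'rV[R]_d => U p.1 p.2) \_ (D T)).
  exact/(measurable_restrictT _ (mD T)).
have : measurable_fun (`]0, T[%classic : set Rm)
    (((fun p : Rm * 'rV[R]_d => U p.1 p.2) \_ (D T)) \o pair^~ x).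
  by apply: measurable_funTS; apply: measurableT_comp => //; exact: pair2_measurable.
apply: eq_measurable_fun => s; rewrite inE => hs.
by rewrite /= patchE /D in_setX (mem_set Ox) (mem_set hs).
Qed.

End time_energy.

(** * The fractional inequality for the space-time norms *)

Section pointwise.
Context {R : realType}.
Local Notation mu := (@lebesgue_measure R).

(** The two coefficients of [discrete_bound].  The first can be made small through
    delta and tau, and delta alone then fixes the second. *)
Definition near_coef (g delta tau : R) : R :=
  2 * (Gamma (1 - g) / Rbeta g) ^+ 2 * ppow g (delta + tau) ^+ 2.

Definition far_coef (g delta T : R) : R :=
  2 * (Gamma (1 - g) / Rbeta g) ^+ 2 * ((g * delta `^ (g - 1)) ^+ 2 * T).

Lemma near_coef_ge0 g delta tau : 0 <= near_coef g delta tau.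
Proof. by apply: mulr_ge0; [apply: mulr_ge0 => //|]; exact: sqr_ge0. Qed.

Lemma far_coef_ge0 g delta T : 0 <= T -> 0 <= far_coef g delta T.
Proof.
move=> T0; apply: mulr_ge0; first by apply: mulr_ge0 => //; exact: sqr_ge0.
by apply: mulr_ge0 => //; exact: sqr_ge0.
Qed.

Variables (g T delta tau : R) (J : nat) (t : nat -> R) (v G : R -> R) (c : nat -> R).
Hypotheses (g01 : 0 < g < 1) (d0 : 0 < delta) (T0 : 0 < T)
  (t0 : t 0%N = 0) (tJ : t J = T)
  (tnd : forall i, (i < J)%N -> t i < t i.+1)
  (ttau : forall i, (i < J)%N -> t i.+1 - t i <= tau)
  (mv : measurable_fun `]0, T[ v) (mG : measurable_fun `]0, T[ G)
  (vc : forall i s, (i < J)%N -> t i < s < t i.+1 -> v s = c i)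
  (vfin : (\int[mu]_(s in `]0%R, T[) (v s ^+ 2)%:E < +oo)%E)
  (Gfin : (\int[mu]_(s in `]0%R, T[) (G s ^+ 2)%:E < +oo)%E)
  (dist : forall i n, (i <= J)%N ->
    \int[mu]_(s in `]0, T[) (((Gamma (1 - g))^-1 *
      \int[mu]_(r in `]0, s[) ((s - r) `^ (1 - g - 1) * v r)) *
      derive1 (cutoff_ppow g (t i) n) s) =
    - \int[mu]_(s in `]0, T[) (G s * cutoff_ppow g (t i) n s)).

Lemma integrable_sqr (f : R -> R) : measurable_fun `]0, T[ f ->
  (\int[mu]_(s in `]0%R, T[) (f s ^+ 2)%:E < +oo)%E ->
  mu.-integrable `]0, T[ (EFin \o (fun s => f s ^+ 2)).
Proof.
move=> mf ffin; apply/integrableP; split.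
  by apply/measurable_EFinP; exact: measurable_funX.
by under eq_integral => s _ do rewrite /= ger0_norm ?sqr_ge0//.
Qed.

Lemma integrable_of_sqr (f : R -> R) : measurable_fun `]0, T[ f ->
  mu.-integrable `]0, T[ (EFin \o (fun s => f s ^+ 2)) ->
  mu.-integrable `]0, T[ (EFin \o f).
Proof.
move=> mf if2.
have mI : measurable (`]0, T[%classic : set (measurableTypeR R)) by exact: measurable_itv.
apply: (@le_integrableR _ _ R mu `]0, T[%classic f (fun s => 1 + f s ^+ 2)) => //.
  by move=> s _; rewrite ler_norml; have := sqr_ge0 (f s - 1);
    have := sqr_ge0 (f s + 1); nra.
apply: integrableRD => //.
by apply: integrable_continuous_itv; exact: cst_continuous.
Qed.

(** Finiteness of the two energies makes v^2 and G^2, hence also G, integrable, so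
    that [discrete_bound] applies to the cell values of v. *)
Lemma pointwise_bound k : (k <= J)%N ->
  (\int[mu]_(s in `]0%R, t k[) (v s ^+ 2)%:E <=
   (near_coef g delta tau)%:E * \int[mu]_(s in `]0%R, t k[) (G s ^+ 2)%:E +
   \sum_(j < k) (far_coef g delta T * (t j.+1 - t j))%:E *
     \int[mu]_(s in `]0%R, t j[) (G s ^+ 2)%:E)%E.
Proof.
move=> kJ.
have iv2 := integrable_sqr mv vfin; have iG2 := integrable_sqr mG Gfin.
have iG := integrable_of_sqr mG iG2.
have finE (f : R -> R) i : (i <= J)%N ->
    mu.-integrable `]0, T[ (EFin \o (fun s => f s ^+ 2)) ->
    (\int[mu]_(s in `]0%R, t i[) (f s ^+ 2)%:E =
      (\int[mu]_(s in `]0%R, t i[) (f s ^+ 2))%:E)%E.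
  move=> iJ intf; rewrite /Rintegral fineK//.
  apply: integrable_fin_num; first exact: measurable_itv.
  apply: integrableS intf; [exact: measurable_itv|exact: measurable_itv|].
  by apply: subset_itvl; rewrite bnd_simp; exact: (@node_leT R J T t).
rewrite finE// finE//.
have -> : (\sum_(j < k) (far_coef g delta T * (t j.+1 - t j))%:E *
     \int[mu]_(s in `]0%R, t j[) (G s ^+ 2)%:E)%E =
   (\sum_(j < k) far_coef g delta T * (t j.+1 - t j) *
     \int[mu]_(s in `]0, t j[) (G s ^+ 2))%:E.
  rewrite -sumEFin; apply: eq_bigr => j _.
  by rewrite finE// (leq_trans _ kJ)// ltnW.
rewrite -EFinM -EFinD lee_fin.
have vc2 i s : (i < J)%N -> t i < s < t i.+1 -> v s ^+ 2 = c i ^+ 2.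
  by move=> iJ si; rewrite (vc iJ si).
rewrite (@step_mass R J T t (fun s => v s ^+ 2) (fun j => c j ^+ 2))//; last first.
  exact: measurable_funX.
have node i : (i <= J)%N -> \sum_(j < i) c j * (t j.+1 - t j) =
    Gamma (1 - g) / Rbeta g * \int[mu]_(s in `]0, T[) (G s * ppow g (t i - s)).
  by move=> iJ; apply: (node_identity g01 t0 tJ tnd mv vc iG iJ) => n; exact: dist.
have tge0 i : (i <= J)%N -> 0 <= t i <= T.
  by move=> iJ; rewrite (@node_ge0 R J t)//= (@node_leT R J T t).
apply: le_trans (discrete_bound g01 d0 T0 tge0 tnd ttau iG iG2 node kJ) _.
rewrite mulrDr mulrA lerD2l mulrA mulr_sumr.
by apply: ler_sum => j _; rewrite mulrA.
Qed.

End pointwise.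

Section energy.
Context {R : realType} {d : nat}.
Local Notation mu := (@lebesgue_measure R).
Local Notation lam := (lebesgueRd R d).

Definition time_sqnorm (Omega : set 'rV[R]_d) (s : R) (U : R -> 'rV[R]_d -> R) : \bar R :=
  (\int[mu]_(r in `]0%R, s[) sqnorm_L2 Omega (U r))%E.

Lemma time_sqnorm_ge0 Omega s U : (0 <= time_sqnorm Omega s U)%E.
Proof.
apply: integral_ge0 => r _; apply: integral_ge0 => x _.
by rewrite lee_fin sqr_ge0.
Qed.

Lemma norm_L2L2_sqr Omega s U :
  (norm_L2L2 Omega s U ^+ 2 = time_sqnorm Omega s U)%E.
Proof.
have := time_sqnorm_ge0 Omega s U; rewrite /norm_L2L2 -/(time_sqnorm _ _ _).
case: (time_sqnorm _ _ _) => [r| |//].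
  rewrite lee_fin => r0; rewrite poweR_EFin -EFin_expe powR12_sqrt//.
  by rewrite sqr_sqrtr.
by move=> _; rewrite poweRyr// expe2 mulyy.
Qed.

Lemma ae_time_energy_fin Omega T (U : R -> 'rV[R]_d -> R) :
  measurable Omega -> in_L2L2 Omega T U ->
  {ae lam, forall x, Omega x -> (time_energy U T x < +oo)%E}.
Proof.
move=> mO [mU Ufin].
have Efin : (time_sqnorm Omega T U < +oo)%E.
  by apply: lty_poweRy Ufin; rewrite invr_eq0.
have : lam.-integrable Omega (time_energy U T).
  apply/integrableP; split; first exact: (measurable_time_energy mO mU).
  rewrite /time_sqnorm (norm_L2L2_time_energy mO mU (lexx T)) in Efin.
  under eq_integral do rewrite gee0_abs ?time_energy_ge0//.
  exact: Efin.
move/(integrable_ae mO); apply: filterS => x fx Ox.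
by rewrite -ge0_fin_numE ?time_energy_ge0// fx.
Qed.

(** The exceptional points x are those where a line energy is infinite, or where the
    distributional identity fails for one of the countably many functions
    [cutoff_ppow g (t i) n]; elsewhere [pointwise_bound] holds, and it is integrated
    in x. *)
Lemma energy_bound (g T delta sigma tau : R) (J : nat) (Omega : set 'rV[R]_d)
    (V DV : R -> 'rV[R]_d -> R) :
  let t := tgrid T sigma J in
  0 < g < 1 -> 0 < delta -> 0 < T -> 1 <= sigma -> (0 < J)%N ->
  measurable Omega ->
  (forall j, (j < J)%N -> t j.+1 - t j <= tau) ->
  in_L2L2 Omega T V ->
  (forall j, (1 <= j <= J)%N -> forall s r, t j.-1 < s < t j ->
     t j.-1 < r < t j -> forall x, Omega x -> V s x = V r x) ->
  is_RL_derivative Omega T g V DV ->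
  forall k, (k <= J)%N ->
  (time_sqnorm Omega (t k) V <=
   (near_coef g delta tau)%:E * time_sqnorm Omega (t k) DV +
   \sum_(j < k) (far_coef g delta T * (t j.+1 - t j))%:E *
     time_sqnorm Omega (t j) DV)%E.
Proof.
move=> t g01 d0 T0 s1 J0 mO ttau VL2 Vstep [DL2 Ddist] k kJ.
have t0 : t 0%N = 0 by exact: tgrid0.
have tJ : t J = T by exact: tgridJ.
have tnd i : (i < J)%N -> t i < t i.+1 by move=> _; exact: tgrid_lt.
have tT i : (i <= J)%N -> t i <= T by move=> iJ; apply: (@node_leT R J T t).
have [mV _] := VL2; have [mDV _] := DL2.
have mDE i : (i <= J)%N -> measurable_fun Omega (time_energy DV (t i)).
  by move=> iJ; apply: (measurable_time_energy mO mDV); exact: tT.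
rewrite /time_sqnorm (norm_L2L2_time_energy mO mV (tT k kJ)).
rewrite (norm_L2L2_time_energy mO mDV (tT k kJ)).
have nc0 := near_coef_ge0 g delta tau.
have fc0 j : (j < J)%N -> 0 <= far_coef g delta T * (t j.+1 - t j).
  move=> jJ; rewrite mulr_ge0 ?subr_ge0 ?(ltW (tnd j jJ))//.
  exact/far_coef_ge0/ltW.
have jJ (j : 'I_k) : (j < J)%N by exact: leq_trans (ltn_ord j) kJ.
have EZ a i : (i <= J)%N -> 0 <= a ->
    (a%:E * \int[lam]_(x in Omega) time_energy DV (t i) x =
     \int[lam]_(x in Omega) (a%:E * time_energy DV (t i) x))%E.
  move=> iJ a0; rewrite ge0_integralZl_EFin//; last exact: mDE.
  by move=> x _; exact: time_energy_ge0.
rewrite EZ//.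
under [X in (_ <= _ + X)%E]eq_bigr => j _.
  rewrite (norm_L2L2_time_energy mO mDV (tT j (ltnW (jJ j)))).
  rewrite (EZ _ _ (ltnW (jJ j)) (fc0 j (jJ j))); over.
rewrite -ge0_integral_sum//; last 2 first.
- move=> j; apply: emeasurable_funM => //; exact: mDE (ltnW (jJ j)).
- by move=> j x _; rewrite mule_ge0 ?time_energy_ge0// lee_fin fc0.
rewrite -ge0_integralD//; last 4 first.
- by move=> x _; rewrite mule_ge0 ?time_energy_ge0// lee_fin.
- by apply: emeasurable_funM => //; exact: mDE.
- by move=> x _; apply: sume_ge0 => j _; rewrite mule_ge0 ?time_energy_ge0// lee_fin fc0.
- apply: emeasurable_sum => j; apply: emeasurable_funM => //; exact: mDE (ltnW (jJ j)).
apply: ae_ge0_le_integral => //.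
- by move=> x _; exact: time_energy_ge0.
- exact: (measurable_time_energy mO mV (tT k kJ)).
- move=> x _; apply: adde_ge0; first by rewrite mule_ge0 ?time_energy_ge0// lee_fin.
  by apply: sume_ge0 => j _; rewrite mule_ge0 ?time_energy_ge0// lee_fin fc0.
- apply: emeasurable_funD; first by apply: emeasurable_funM => //; exact: mDE.
  apply: emeasurable_sum => j; apply: emeasurable_funM => //; exact: mDE (ltnW (jJ j)).
have dist : {ae lam, forall x, forall i n, (i <= J)%N -> Omega x ->
    \int[mu]_(s in `]0, T[) (RL_integral (1 - g) V s x * derive1 (cutoff_ppow g (t i) n) s) =
    - \int[mu]_(s in `]0, T[) (DV s x * cutoff_ppow g (t i) n s)}.
  apply/ae_foralln => i; apply/ae_foralln => n.
  have [iJ|iJ] := leqP i J; last first.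
    by apply: aeW => x h; move: iJ; rewrite ltnNge h.
  have := Ddist _ (time_test_cutoff_ppow g n (tT i iJ)).
  by apply: filterS => x h _; exact: h.
have vf := ae_time_energy_fin mO VL2; have gf := ae_time_energy_fin mO DL2.
move: dist vf gf; apply: filterS3 => x dist vf gf Ox.
apply: (@pointwise_bound R g T delta tau J t (V ^~ x) (DV ^~ x)
  (fun j => V ((t j + t j.+1) / 2) x)) => //.
- exact: (measurable_time_section mO mV).
- exact: (measurable_time_section mO mDV).
- move=> i s iJ si; apply: (Vstep i.+1) => //=.
  by have h := midf_lt (tnd i iJ); rewrite !h.
- exact: vf.
- exact: gf.
- by move=> i n iJ; exact: dist.
Qed.

End energy.

(** * The stability estimate *)

Section coefs.
Context {R : realType}.

(** The coefficient is a multiple of (delta + tau)^(2 g), so delta is obtained by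
    extracting a root. *)
Lemma near_coef_small (g A : R) : 0 < g -> 0 < A ->
  exists2 delta, 0 < delta &
    forall tau, tau <= delta -> A * near_coef g delta tau <= 2^-1.
Proof.
move=> g0 A0; set K := (Gamma (1 - g) / Rbeta g) ^+ 2.
have K0 : 0 <= K by exact: sqr_ge0.
(* the bound on (delta + tau)^(2 g) that brings A * near_coef below 1/2; K + 1
   instead of K keeps the denominator positive *)
pose q := (4 * A * (K + 1))^-1.
have q0 : 0 < q by rewrite invr_gt0 !mulr_gt0// ltr_wpDl.
pose D := (Num.sqrt q) `^ (g^-1).
have D0 : 0 < D by rewrite powR_gt0// sqrtr_gt0.
exists (D / 2) => [|tau td]; first by rewrite divr_gt0.
have pq : ppow g (D / 2 + tau) ^+ 2 <= q.
  have -> : q = ppow g D ^+ 2.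
    by rewrite ppow_gt0E// /D -powRrM mulVf ?gt_eqF// powRr1 ?sqrtr_ge0// sqr_sqrtr ?(ltW q0).
  by rewrite ler_pXn2r ?nnegrE ?ppow_ge0// le_ppow//; lra.
rewrite /near_coef -/K.
apply: (@le_trans _ _ (A * (2 * K * q))).
  by rewrite !ler_wpM2l ?(ltW A0)// mulr_ge0.
rewrite /q (_ : _ * _ = K / (2 * (K + 1))); last first.
  by field; rewrite !gt_eqF ?ltr_wpDl.
rewrite ler_pdivrMr; last by rewrite mulr_gt0// ltr_wpDl.
by lra.
Qed.

End coefs.

Unset Implicit Arguments.
Set Strict Implicit.
Set Printing Implicit Defensive.

Theorem lemma5p1 (R : realType) (alpha A T : R) (alpha_gt0 : 0 < alpha)
    (alpha_lt1 : alpha < 1) (A_gt0 : 0 < A) (T_gt0 : 0 < T) :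
  exists tau_star C : R, 0 < tau_star /\ 0 < C /\
  forall (d : nat) (Omega : set 'rV[R]_d) (N : nat)
      (K : 'I_N -> 'I_d.+1 -> 'rV[R]_d) (kappa h : R)
      (J : nat) (sigma epsilon : R) (V DV : R -> 'rV[R]_d -> R),
    (1 <= d <= 3)%N ->
    convex_polytope Omega ->
    triangulation Omega K kappa h ->
    (0 < J)%N -> 1 <= sigma -> 0 < epsilon ->
    let t := tgrid T sigma J in
    let tau := t J - t J.-1 in
    in_W Omega K T sigma J V ->
    is_RL_derivative Omega T (alpha / 2) V DV ->
    (forall j, (1 <= j <= J)%N ->
      (norm_L2L2 Omega (t j) DV ^+ 2 <=
        epsilon%:E + A%:E * norm_L2L2 Omega (t j) V ^+ 2)%E) ->
    tau < tau_star ->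
    forall j, (1 <= j <= J)%N ->
      (norm_L2L2 Omega (t j) DV <=
        (Num.sqrt epsilon * C *
          expR (2^-1 * j%:R * sigma * T * J%:R^-1 * (tau_star - tau)^-1))%:E)%E.
Proof.
have g01 : 0 < alpha / 2 < 1 by apply/andP; split; lra.
have /andP[g0 g1] := g01.
have [delta d0 Hdelta] := @near_coef_small R (alpha / 2) A g0 A_gt0.
set fc := far_coef (alpha / 2) delta T.
have fc0 : 0 <= fc by apply/far_coef_ge0/ltW.
pose L := 2 * A * fc.
have L0 : 0 <= L by apply: mulr_ge0 => //; apply: mulr_ge0 => //; exact: ltW.
have L10 : 0 < L + 1 by rewrite ltr_wpDl.
(* L + 1 instead of L, to invert a positive number *)
exists (Num.min delta (L + 1)^-1), (Num.sqrt 2).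
set ts := Num.min _ _.
have ts0 : 0 < ts by rewrite lt_min d0 invr_gt0.
split=> //; split; first by rewrite sqrtr_gt0.
move=> d Omega N K kappa h J sigma eps V DV _ poly _ J0 s1 e0 t tau VW RLV H tau_lt j.
move=> /andP[j0 jJ].
have mO : measurable Omega.
  have [S _ [-> _]] := poly; apply: open_measurable_rV; exact: open_interior.
have [VL2 _ Vstep] := VW.
have t_incr i : t i < t i.+1 by exact: tgrid_lt.
have ttau i : (i < J)%N -> t i.+1 - t i <= tau.
  move=> iJ; have := @tgrid_step_le R T sigma J T_gt0 s1 J0 i J.-1.
  by rewrite prednK//; apply; rewrite -ltnS prednK.
have tau0 : 0 <= tau by rewrite subr_ge0 -[in leRHS](prednK J0); exact/ltW.
have tausT := @tgrid_last_step_le R T sigma J T_gt0 s1 J0; rewrite -/t -/tau in tausT.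
have taud : tau <= delta by apply/ltW/(lt_le_trans tau_lt); rewrite ge_min lexx.
have [DL2 _] := RLV.
have tT i : (i <= J)%N -> t i <= T.
  move=> iJ; have <- : t J = T by exact: tgridJ.
  by apply: (@node_mono R J t (fun i _ => t_incr i)); rewrite iJ leqnn.
have fin i U : (i <= J)%N -> in_L2L2 Omega T U -> time_sqnorm Omega (t i) U \is a fin_num.
  move=> iJ UL2; rewrite ge0_fin_numE ?time_sqnorm_ge0//.
  have : (time_sqnorm Omega T U < +oo)%E.
    by case: UL2 => _; apply: lty_poweRy; rewrite invr_eq0.
  apply: le_lt_trans; case: UL2 => mU _.
  rewrite /time_sqnorm (norm_L2L2_time_energy mO mU (tT i iJ)).
  rewrite (norm_L2L2_time_energy mO mU (lexx T)).
  apply: ge0_le_integral => //.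
  - by move=> x _; exact: time_energy_ge0.
  - exact: (measurable_time_energy mO mU (tT i iJ)).
  - exact: (measurable_time_energy mO mU (lexx T)).
  - move=> x Ox; apply: ge0_subset_integral => //.
    + apply/measurable_EFinP.
      exact: (measurable_funX _ (measurable_time_section mO mU Ox)).
    + by move=> s _; rewrite lee_fin sqr_ge0.
    + by apply: subset_itvl; rewrite bnd_simp tT.
pose b i := fine (time_sqnorm Omega (t i) DV).
have bE i : (i <= J)%N -> time_sqnorm Omega (t i) DV = (b i)%:E.
  by move=> iJ; rewrite /b fineK// fin.
have b0 i : 0 <= b i by apply: fine_ge0; exact: time_sqnorm_ge0.
have Hb k : (k <= J)%N -> b k <= 2 * eps + L * \sum_(i < k) (t i.+1 - t i) * b i.
  move=> kJ.
  have S0 : 0 <= \sum_(i < k) (t i.+1 - t i) * b i.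
    by apply: sumr_ge0 => i _; rewrite mulr_ge0// subr_ge0 ltW.
  case: k kJ S0 => [|k] kJ S0.
    (* the hypothesis speaks of j >= 1 only, but ]0, t 0[ is empty *)
    rewrite big_ord0 mulr0 addr0 /b /time_sqnorm.
    rewrite (_ : t 0%N = 0); last exact: tgrid0.
    rewrite set_itv_ge ?integral_set0/= ?mulr_ge0 ?(ltW e0)//.
    by rewrite bnd_simp ltxx.
  have := energy_bound g01 d0 T_gt0 s1 J0 mO ttau VL2 Vstep RLV kJ.
  have := H k.+1; rewrite kJ => /(_ isT).
  rewrite !norm_L2L2_sqr -/t bE//.
  have -> : (\sum_(j0 < k.+1) (far_coef (alpha / 2) delta T * (t j0.+1 - t j0))%:E *
      time_sqnorm Omega (t j0) DV)%E = (fc * \sum_(i < k.+1) (t i.+1 - t i) * b i)%:E.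
    rewrite mulr_sumr -sumEFin; apply: eq_bigr => i _.
    rewrite bE; last by rewrite ltnW// (leq_trans (ltn_ord i) kJ).
    by rewrite -EFinM mulrA.
  rewrite -(fineK (fin k.+1 V kJ VL2)) -!EFinM -!EFinD !lee_fin.
  set a := fine _; set S := \sum_(i < _) _ in S0 *.
  move=> h1 h2.
  (* the near term is absorbed into the left-hand side *)
  have h3 := Hdelta _ taud.
  have h4 : A * near_coef (alpha / 2) delta tau * b k.+1 <= 2^-1 * b k.+1 by rewrite ler_wpM2r.
  have h5 : A * a <= A * (near_coef (alpha / 2) delta tau * b k.+1 + fc * S).
    by rewrite ler_wpM2l// ltW.
  rewrite /L; lra.
have wt i : (i < J)%N -> 0 <= t i.+1 - t i <= tau.
  by move=> iJ; rewrite subr_ge0 (ltW (t_incr i)) ttau.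
have e20 : 0 <= 2 * eps by rewrite mulr_ge0// ltW.
have B := discrete_gronwall e20 L0 wt Hb jJ.
have NE : norm_L2L2 Omega (t j) DV = (Num.sqrt (b j))%:E.
  rewrite /norm_L2L2 -/(time_sqnorm _ _ _) bE// poweR_EFin powR12_sqrt//.
rewrite NE lee_fin.
set X := (X in expR X).
have -> : Num.sqrt eps * Num.sqrt 2 * expR X = Num.sqrt (2 * eps * expR (2 * X)).
  rewrite sqrtrM// sqrtrM// [2 * X]mulrC expRM_natr sqrtr_sqr ger0_norm ?expR_ge0//.
  by rewrite [Num.sqrt 2 * _]mulrC.
rewrite ler_sqrt; last by rewrite mulr_ge0 ?expR_ge0.
apply: (le_trans B); rewrite ler_wpM2l// ler_expR.
have tst : 0 < ts - tau by rewrite subr_gt0.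
(* this is where the factor 1 / (tau_star - tau) of the estimate comes from *)
have Lts : L <= (ts - tau)^-1.
  apply: (@le_trans _ _ (L + 1)); first by rewrite lerDl.
  rewrite -[leLHS]invrK lef_pV2 ?posrE ?invr_gt0//.
  apply: (@le_trans _ _ ts); first by rewrite gerBl.
  by rewrite ge_min lexx orbT.
have -> : 2 * X = (ts - tau)^-1 * (j%:R * (sigma * T / J%:R)).
  by rewrite /X; field; rewrite !gt_eqF// ltr0n.
apply: ler_pM => //; first by rewrite mulr_ge0.
by rewrite ler_wpM2l.
Qed.
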